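(* For every integer $g\ge 0$, the generating function $\mathbf{C}^{[2]}_g(z)=\sum_{n\ge 0}\mathbf{c}^{[2]}_g(n)z^n$ is a rational function with integer coefficients of the form $$\mathbf{C}_g^{[2]}(z)=\frac{P_g^{[2]}(z)}{(1-4z)^{3g+2}},$$ where $P_g^{[2]}(z)$ is a polynomial with integer coefficients of degree at most $3g+1$, satisfying $P_g^{[2]}(1/4)>0$ and $[z^h]P_g^{[2]}(z)=0$ for $0\le h\le 2g$. Furthermore, $$P_g^{[2]}(z)=z^{-1}P_{g+1}(z)-\sum_{g_1=1}^{g}P_{g_1}(z)P_{g+1-g_1}(z),$$ $$[z^{2g+1}]P^{[2]}_g(z)=\mathbf{c}^{[2]}_g(2g+1)=\mathbf{c}_{g+1}(2g+2)=\frac{(4g+4)!}{4^{g+1}(2g+3)!},$$ and as $n\to\infty$, $$[z^n]\mathbf{C}_g^{[2]}(z)\sim \frac{P_g^{[2]}(1/4)}{\Gamma(3g+2)}\,n^{3g+1}4^n.$$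
   Context: For a power series $T(z)$, $[z^i]T(z)$ denotes the coefficient of $z^i$. Permutations are composed right to left. One-backbone chord diagrams: a chord diagram on one backbone with $n\ge 0$ chords is a fixed-point-free involution $\iota$ of $\{1,\dots,2n\}$ (the $2n$ points in order along an oriented interval, paired into $n$ chords). With $\tau=(1,2,\dots,2n)$, let $r$ be the number of disjoint cycles of $\tau\circ\iota$; the genus is $g=(n+1-r)/2$ (for $n=0$ there is one diagram, of genus $0$). Let $\mathbf{c}_g(n)$ be the number of such diagrams with $n$ chords and genus $g$, and $\mathbf{C}_g(z)=\sum_{n\ge0}\mathbf{c}_g(n)z^n$. It is known (earlier work) that for each $g\ge1$ there is a polynomial $P_g(z)$ with integer coefficients (divisible by $z^{2g}$, of degree at most $3g-1$) such that $\mathbf{C}_g(z)=P_g(z)/(1-4z)^{3g-1/2}$; $P_g$ denotes this polynomial. Two-backbone chord diagrams: for $n\ge1$, a chord diagram on two backbones with $n$ chords consists of an integer $c$ with $1\le c\le 2n-1$ (points $1,\dots,c$ lie in order on the first oriented interval and $c+1,\dots,2n$ in order on the second, the first interval lying to the left of the second on the real line) together with a fixed-point-free involution $\iota$ of $\{1,\dots,2n\}$ (the chords). It is connected if the graph formed by the two intervals and the chords is connected, i.e. some chord joins a point in $\{1,\dots,c\}$ to a point in $\{c+1,\dots,2n\}$. Let $\tau_c=(1,\dots,c)\circ(c+1,\dots,2n)$ and $r$ the number of disjoint cycles of $\tau_c\circ\iota$; the genus of a connected such diagram is $g=(n-r)/2$. Let $\mathbf{c}^{[2]}_g(n)$ be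 the number of connected chord diagrams on two backbones with $n$ chords and genus $g$ (and $\mathbf{c}^{[2]}_g(0)=0$). *)

(* Defs.v *)
From HB Require Import structures.
From mathcomp Require Import all_boot all_order all_algebra all_fingroup.
From mathcomp Require Import zify.
Unset Strict Implicit. Unset Printing Implicit Defensive.
Import Order.TTheory GRing.Theory Num.Theory.

(* Points 1..m of the paper are the ordinals 0..m-1 of 'I_m. *)

(* tau_c on {0,..,m-1}: the cycles (0 .. c-1)(c .. m-1)  (c is clamped to m,
   so that for c = m it is the single cycle (0 .. m-1)). *)
Definition tauf (c m i : nat) : nat :=
  let c' := minn c m in
  if i.+1 == c' then 0 else if i.+1 == m then c' else i.+1.

Definition tau_fun (c m : nat) (i : 'I_m) : 'I_m := insubd i (tauf c m i).

Lemma tauf_lt (c m i : nat) : i < m -> tauf c m i < m.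
Proof. rewrite /tauf; do ! case: ifP; move=> /eqP ? //; lia. Qed.

Lemma tau_inj (c m : nat) : injective (@tau_fun c m).
Proof.
move=> i j /(congr1 val); rewrite /tau_fun !val_insubd !tauf_lt //.
move=> h; apply: val_inj => /=; move: h; rewrite /tauf.
have := ltn_ord i; have := ltn_ord j.
by do ! case: ifP; move=> /eqP ? //; lia.
Qed.

Definition tau (c m : nat) : {perm 'I_m} := perm (@tau_inj c m).

Definition ncycles {m : nat} (s : {perm 'I_m}) : nat := #|porbits s|.

Definition fpf_involution {m : nat} (s : {perm 'I_m}) : bool :=
  (s * s == 1)%g && [forall x, s x != x].

(* NB: in mathcomp, (s * t) x = t (s x); hence  tau o iota  is  iota * tau. *)

(* c_g(n): one-backbone chord diagrams with n chords and genus g,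
   genus g  <=>  n + 1 - r = 2 g  with r = #cycles of tau o iota.
   For n = 0 there is exactly one diagram, of genus 0. *)
Definition c1 (g n : nat) : nat :=
  if n is 0 then (g == 0 : nat) else
  #|[set s : {perm 'I_(2 * n)} |
      fpf_involution s && (n.+1 == 2 * g + ncycles (s * tau (2 * n) (2 * n))%g)]|.

(* connectedness of a two-backbone diagram (first backbone = points < c) *)
Definition connected2 {m : nat} (c : nat) (s : {perm 'I_m}) : bool :=
  [exists x : 'I_m, (x < c) && (c <= s x)].

(* c^[2]_g(n): connected two-backbone diagrams with n chords and genus g,
   genus g <=> n - r = 2 g. *)
Definition c2 (g n : nat) : nat :=
  \sum_(1 <= c < 2 * n)
    #|[set s : {perm 'I_(2 * n)} |
        [&& fpf_involution s, connected2 c s &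
            n == 2 * g + ncycles (s * tau c (2 * n))%g]]|.

Local Open Scope ring_scope.

Definition gbinom (a : rat) (j : nat) : rat :=
  (\prod_(i < j) (a - i%:R)) / (j`!)%:R.

(* [z^j] (1 - 4z)^(a)  =  binom(a, j) (-4)^j *)
Definition pow14 (a : rat) (j : nat) : rat := gbinom a j * (-4) ^+ j.

(* P_g as the formal power series  C_g(z) (1 - 4z)^(3g - 1/2);
   [z^k] P_g = Pcoef g k.  (For g >= 1 this is the polynomial P_g.) *)
Definition Pcoef (g k : nat) : rat :=
  \sum_(i < k.+1) (c1 g i)%:R * pow14 ((3 * g)%:R - 2^-1) (k - i).

(* Main.v *)
(** The [c_g(n)] are the coefficients of the polynomial
[T_n(N) = sum_iota N^(cycles of tau iota)].  Averaging over all long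
cycles [tau] instead of over [iota], and writing the indicator of long cycles as the
alternating sum over the invariant sets [S] that avoid a base point of
[(-1)^(cycles in S)], one is left for each [S] with a signed sum over the stabilizer
of [S].  A sign-reversing involution kills it unless [S] is stable under [iota] up to
at most one point, and what remains is a product of a falling and a rising factorial.
Hence [sum_N T_n(N) x^N = (2n-1)!! x (1+x)^n / (1-x)^(n+2)], which gives the
Harer-Zagier recursion.

In the normalisation [c_g(n) n! / (2n)!] the recursion says that, for [g >= 1], the
exponential-type series is [B_g(x) e^x] for an explicit polynomial [B_g] supported in
degrees [2g..3g-1].  Since the coefficients of [z^k (1-4z)^(-k-1/2)] are
[(2n)! k! / (n! (2k)! (n-k)!)], this is the rational form of [C_g], with the value of
[P_g] at [1/4] given by the top coefficient of [B_g].

Deleting the chord at the first point of a one-backbone diagram leaves either a connected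
two-backbone diagram or a pair of one-backbone diagrams; with [1 - 2 z C_0 = sqrt (1-4z)]
this expresses [P^[2]_g] through the [P_g], and [P^[2]_g(1/4) > 0] follows from
log-convexity of the sequence [P_g(1/4)]. *)
Require Import Defs.
From HB Require Import structures.
From mathcomp Require Import all_boot all_order all_algebra all_fingroup.
From mathcomp Require Import boolp zify ring lra.
Import Order.TTheory GRing.Theory Num.Theory.
Set Implicit Arguments. Unset Strict Implicit.
Local Open Scope ring_scope.

(** * Invariant sets of a permutation *)

(** With the long cycle fixed, the pairings form a conjugacy class and not a group, and the sum over
    them of [N] to the number of cycles does not factor. Once all long cycles are allowed and their
    indicator is expanded, the free variable runs over the stabilizer of [S], a product of two
    symmetric groups, where such sums do factor. The expansion is a determinant: delete the row and
    column of [p] from [1 - s], for the matrix of [s]; this minor is the sum over [S] avoiding [p]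
    of [(-1) ^ #|S|] times the principal minor of [s] on [S], which is a sign if [S] is stable and 0
    otherwise. It is 1 for a long cycle and 0 if some cycle misses [p]. The weight is [q ^+ plen]
    with [q = 1/N], because [plen] is invariant under conjugation and grows by one when a
    transposition merges two cycles. The recursion comes from a series indexed by the evaluation
    points [N], where multiplication by the polynomial variable becomes the Euler operator. *)

Lemma perm_astabsP (T : finType) (S : {set T}) (s : {perm T}) :
  reflect (forall x, (s x \in S) = (x \in S)) (s \in ('N(S | 'P))%g).
Proof.
apply: (iffP idP) => [sN x | h]; first by rewrite -(astabs_act x sN).
by rewrite !inE; apply/subsetP => x xS; rewrite inE /= /aperm h.
Qed.

Lemma restr_perm_out (T : finType) (S : {set T}) (s : {perm T}) x :
  x \notin S -> restr_perm S s x = x.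
Proof. by move=> xS; apply: (out_perm (restr_perm_on S s)). Qed.

Lemma astabs_porbit (T : finType) (S : {set T}) (s : {perm T}) x y :
  s \in ('N(S | 'P))%g -> y \in porbit s x -> (y \in S) = (x \in S).
Proof.
move=> /perm_astabsP sN /porbitP[i ->].
by elim: i => [|i IH]; rewrite ?perm1 // expgSr permM sN.
Qed.

Lemma mem_cover_porbits (T : finType) (s : {perm T}) (P : {set {set T}}) x :
  P \subset porbits s -> (x \in cover P) = (porbit s x \in P).
Proof.
move=> sP; apply/bigcupP/idP => [[B BP xB]|]; last by exists (porbit s x); rewrite ?porbit_id.
have /imsetP[y _ Ey] := subsetP sP _ BP.
by move: xB BP; rewrite Ey -eq_porbit_mem => /eqP ->.
Qed.

Lemma cover_porbits_astabs (T : finType) (s : {perm T}) (P : {set {set T}}) :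
  P \subset porbits s -> s \in ('N(cover P | 'P))%g.
Proof.
move=> sP; apply/perm_astabsP => x; rewrite !(mem_cover_porbits _ sP).
by have := porbit_perm s 1 x; rewrite expg1 => ->.
Qed.

Lemma imset_porbit_cover (T : finType) (s : {perm T}) (P : {set {set T}}) :
  P \subset porbits s -> porbit s @: cover P = P.
Proof.
move=> sP; apply/setP => B; apply/imsetP/idP => [[x /bigcupP[C CP xC] ->]|BP].
  have /imsetP[y _ Ey] := subsetP sP _ CP.
  by move: xC CP; rewrite Ey -eq_porbit_mem => /eqP ->.
have /imsetP[y _ Ey] := subsetP sP _ BP; exists y => //.
by apply/bigcupP; exists B => //; rewrite Ey porbit_id.
Qed.

Lemma cover_imset_porbit (T : finType) (s : {perm T}) (S : {set T}) :
  s \in ('N(S | 'P))%g -> cover (porbit s @: S) = S.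
Proof.
move=> sN; apply/setP => x; apply/bigcupP/idP => [[B /imsetP[y yS ->]]|xS].
  by move=> /(astabs_porbit sN) ->.
by exists (porbit s x); rewrite ?imset_f ?porbit_id.
Qed.

(** A stable set is the union of the cycles it contains, so [cover] and the image under [porbit s]
    are mutually inverse. *)
Lemma sum_astabs (R : nmodType) (T : finType) (s : {perm T}) (p : T)
    (h : {set T} -> R) :
  \sum_(S : {set T} | (s \in ('N(S | 'P))%g) && (p \notin S)) h S
  = \sum_(P in powerset (porbits s :\ porbit s p)) h (cover P).
Proof.
rewrite (reindex_onto (fun P : {set {set T}} => cover P) (fun S => porbit s @: S)) /=;
  last by move=> S /andP[sN _]; apply: cover_imset_porbit.
apply: eq_bigl => P; rewrite powersetE subsetD1.
apply/idP/idP => [/andP[/andP[sN pP] /eqP E]|/andP[sP pP]].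
  have sP : P \subset porbits s.
    by rewrite -E; apply/subsetP => _ /imsetP[x _ ->]; apply: imset_f.
  by rewrite sP -(mem_cover_porbits _ sP).
by rewrite imset_porbit_cover // cover_porbits_astabs // (mem_cover_porbits _ sP) pP eqxx.
Qed.

Lemma sum_powerset_card (R : nmodType) (T : finType) (A : {set T}) (h : nat -> R) :
  \sum_(P in powerset A) h #|P| = \sum_(j < #|A|.+1) h j *+ 'C(#|A|, j).
Proof.
rewrite (partition_big (fun P : {set T} => inord #|P| : 'I_#|A|.+1) xpredT) //=.
apply: eq_bigr => j _; rewrite -cards_draws -sumr_const; apply: congr_big => // [P|P].
  rewrite powersetE inE; case: (boolP (P \subset A)) => //= sPA.
  by rewrite -val_eqE /= inordK // ltnS subset_leq_card.
rewrite powersetE => /andP[sPA /eqP <-].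
by rewrite inordK // ltnS subset_leq_card.
Qed.

Lemma sum_powerset_sign (R : pzRingType) (T : finType) (A : {set T}) :
  \sum_(P in powerset A) (-1) ^+ #|P| = (A == set0)%:R :> R.
Proof.
rewrite (sum_powerset_card A (fun j => (-1) ^+ j)).
have := exprBn_comm #|A| (commr1 (1 : R)).
rewrite subrr => E; transitivity (0 ^+ #|A| : R).
  by rewrite E; apply: eq_bigr => i _; rewrite !expr1n !mulr1.
by rewrite -cards_eq0; case: #|A| => [|n]; rewrite ?expr0 // expr0n.
Qed.

Lemma porbits_restr_perm (T : finType) (S : {set T}) (s : {perm T}) :
  s \in ('N(S | 'P))%g ->
  #|porbits (restr_perm S s)| = (#|porbit s @: S| + #|~: S|)%N.
Proof.
move=> sN; set r := restr_perm S s.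
have rS x : x \in S -> porbit r x = porbit s x.
  move=> xS; have rx i : ((r ^+ i) x = (s ^+ i) x)%g.
    elim: i => [|i IH]; first by rewrite !expg0.
    rewrite !expgSr !permM IH restr_permE //.
    by rewrite (astabs_porbit sN (mem_porbit s i x)).
  by apply/setP => y; apply/porbitP/porbitP => -[i ->]; exists i; rewrite rx.
have rC x : x \notin S -> porbit r x = [set x].
  move=> xS; apply/setP => y; rewrite inE; apply/porbitP/eqP => [[i ->]|->].
    by elim: i => [|i IH]; rewrite ?perm1 // expgSr permM IH restr_perm_out.
  by exists 0%N; rewrite perm1.
have -> : porbits r = (porbit s @: S) :|: (set1 @: (~: S)).
  apply/setP => B; rewrite in_setU; apply/imsetP/orP => [[x _ ->]|[]/imsetP[x xS ->]].
  - have [xS|xS] := boolP (x \in S); [left; rewrite rS | right; rewrite rC] => //;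
      by apply: imset_f; rewrite ?inE.
  - by exists x; rewrite ?rS.
  - by exists x; rewrite ?rC //; rewrite inE in xS.
rewrite cardsU [X in (_ - X)%N](_ : _ = 0%N) ?subn0.
  by rewrite [X in (_ + X)%N]card_imset //; apply: set1_inj.
apply/eqP; rewrite cards_eq0 -subset0; apply/subsetP => B.
rewrite inE => /andP[/imsetP[x xS ->] /imsetP[y yS E]].
have : y \in porbit s x by rewrite E inE.
by move/(astabs_porbit sN); rewrite xS; move: yS; rewrite inE => /negPf ->.
Qed.

(** A permutation of [S] with c cycles has sign [(-1) ^ (#|S| - c)]; the fixed points of
    [restr_perm S s] outside [S] do not affect the parity. *)
Lemma restr_perm_sign (R : pzRingType) (T : finType) (S : {set T}) (s : {perm T}) :
  s \in ('N(S | 'P))%g ->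
  (-1) ^+ #|S| * (-1) ^+ restr_perm S s = (-1) ^+ #|porbit s @: S| :> R.
Proof.
move=> sN; rewrite -exprD -[LHS]signr_odd -[RHS]signr_odd; congr (_ ^+ nat_of_bool _).
rewrite oddD oddb /odd_perm porbits_restr_perm // -(cardsC S) !oddD.
by do 3 case: odd.
Qed.

(* The stable sets avoiding [p] are the unions of the cycles not through [p];
   if there is such a cycle, the signs cancel. *)
Lemma long_cycle_sign_sum (R : pzRingType) (T : finType) (s : {perm T}) (p : T) :
  \sum_(S : {set T} | (s \in ('N(S | 'P))%g) && (p \notin S))
     (-1) ^+ #|S| * (-1) ^+ restr_perm S s = (#|porbits s| == 1%N)%:R :> R.
Proof.
rewrite sum_astabs; transitivity
  (\sum_(P in powerset (porbits s :\ porbit s p)) (-1) ^+ #|P| : R).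
  apply: eq_bigr => P; rewrite powersetE subsetD1 => /andP[sP _].
  by rewrite restr_perm_sign ?cover_porbits_astabs // imset_porbit_cover.
rewrite sum_powerset_sign -cards_eq0 [#|porbits s|](cardsD1 (porbit s p)) imset_f //.
Qed.

(** * Signed sums over stabilizers *)

(** The least number of transpositions with product [s]. At [q = 1/N], multiplying [q ^+ plen s] by
    [N ^ #|T|] gives [N] to the number of cycles. *)
Definition plen (T : finType) (s : {perm T}) : nat := (#|T| - #|porbits s|)%N.

Lemma card_porbits_le (T : finType) (s : {perm T}) : (#|porbits s| <= #|T|)%N.
Proof. by rewrite (leq_trans (leq_imset_card _ _)) // max_card. Qed.

Lemma card_porbitsJ (T : finType) (s t : {perm T}) : #|porbits (s ^ t)%g| = #|porbits s|.
Proof.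
have E x : porbit (s ^ t)%g (t x) = t @: porbit s x.
  apply/setP => y; apply/porbitP/imsetP => [[i ->]|[z /porbitP[i ->] ->]].
    by exists ((s ^+ i)%g x); rewrite ?mem_porbit // -conjXg permJ.
  by exists i; rewrite -conjXg permJ.
rewrite -[RHS](card_imset (porbits s) (imset_inj (@perm_inj _ t))).
congr #|pred_of_set _|; apply/setP => B; apply/imsetP/imsetP => [[x _ ->]|].
  exists (porbit s (t^-1 x)%g); first exact: imset_f.
  by rewrite -E permKV.
by move=> [_ /imsetP[x _ ->] ->]; exists (t x); rewrite ?E.
Qed.

Lemma plenJ (T : finType) (s t : {perm T}) : plen (s ^ t)%g = plen s.
Proof. by rewrite /plen card_porbitsJ. Qed.

Lemma card_porbits_tperm (T : finType) (s : {perm T}) a b :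
  a != b -> a \notin porbit s b ->
  #|porbits s| = #|porbits (tperm a b * s)%g|.+1.
Proof. by move=> ab aNb; have := porbits_mul_tperm s a b; rewrite /= aNb ab; lia. Qed.

Lemma plen_mul_tperm (T : finType) (s : {perm T}) a b :
  a != b -> a \notin porbit s b -> plen (tperm a b * s)%g = (plen s).+1.
Proof.
move=> ab aNb; have E := card_porbits_tperm ab aNb.
by have := card_porbits_le s; rewrite /plen; lia.
Qed.

Lemma notin_porbit_fixed (T : finType) (s : {perm T}) a b :
  a != b -> s a = a -> a \notin porbit s b.
Proof.
move=> ab sa; rewrite porbit_sym; apply/negP => /porbitP[i].
have -> : (s ^+ i)%g a = a by elim: i => [|i IH]; rewrite ?perm1 // expgSr permM IH.
by move=> E; rewrite E eqxx in ab.
Qed.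

Lemma perm_on_set0 (T : finType) (s : {perm T}) : perm_on set0 s = (s == 1%g).
Proof.
apply/idP/eqP => [s0|->]; last exact: perm_on1.
by apply/permP => x; rewrite perm1 (out_perm s0) ?inE.
Qed.

(** Write [s] as [tperm a b] times a permutation fixing [a], where [b] is the preimage of [a]: the
    choice [b = a] contributes 1 and each other choice [e * q]. The factor [u] is a passenger,
    moving only points outside [S]; [e] is later 1 or -1. *)
Lemma sum_perm_on_plen (R : comPzRingType) (T : finType) (q e : R)
    (S : {set T}) (u : {perm T}) :
  e * e = 1 -> perm_on (~: S) u ->
  \sum_(s : {perm T} | perm_on S s) e ^+ s * q ^+ plen (s * u)%g
  = \prod_(i < #|S|) (1 + e * i%:R * q) * q ^+ plen u.
Proof.
move=> ee; move: {2}#|S| (erefl #|S|) => n; elim: n S => [|n IH] S cS uS.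
  rewrite cS big_ord0 mul1r (big_pred1 1%g) ?odd_perm1 ?mul1g ?mul1r // => s.
  by move/eqP: cS; rewrite cards_eq0 => /eqP ->; rewrite perm_on_set0.
have [a aS] : exists a, a \in S by apply/card_gt0P; rewrite cS.
have cS' : #|S :\ a| = n by have := cardsD1 a S; rewrite aS cS => -[].
have uS' : perm_on (~: (S :\ a)) u.
  by apply: (subset_trans uS); rewrite setCS subD1set.
rewrite (partition_big (fun s : {perm T} => (s^-1)%g a) (mem S)) /=; last first.
  by move=> s sS; rewrite -(perm_closed _ sS) permKV.
have step b : b \in S ->
    \sum_(s | perm_on S s && ((s^-1)%g a == b)) e ^+ s * q ^+ plen (s * u)%g
    = (if b == a then 1 else e * q) *
       (\prod_(i < n) (1 + e * i%:R * q) * q ^+ plen u).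
  move=> bS; rewrite -cS' -(IH _ cS' uS') mulr_sumr.
  rewrite (reindex_inj (mulgI (tperm a b))) /=.
  apply: congr_big => // [s|s /andP[sS /eqP Es]].
    apply/andP/idP => [[tS /eqP E]|sS].
      have sa : s a = a.
        by move/(congr1 (tperm a b * s)%g): E; rewrite permKV permM tpermR.
      apply/subsetP => x; rewrite !inE => sx; apply/andP; split.
        by apply: contraNneq sx => ->; rewrite sa.
      have [->//|xa] := eqVneq x a; have [->//|xb] := eqVneq x b.
      apply: contraR sx => xS; rewrite -[X in _ == X](out_perm tS xS).
      by rewrite permM tpermD // eq_sym.
    split; last by rewrite (canF_eq (permKV _)) permM tpermR (out_perm sS) ?setD11.
    apply: perm_onM; last by apply: subset_trans sS (subD1set _ _).
    apply/subsetP => x; rewrite inE => tx.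
    have [->//|xa] := eqVneq x a; have [->//|xb] := eqVneq x b.
    by move: tx; rewrite tpermD ?eqxx // eq_sym.
  have sa : s a = a.
    by move/(congr1 (tperm a b * s)%g): Es; rewrite permKV permM tpermR.
  have ua : u a = a by rewrite (out_perm uS) // inE aS.
  have [->|ba] := eqVneq b a; first by rewrite tperm1 mul1g mul1r.
  (* [s * u] fixes [a], so the transposition joins a one-point cycle to another cycle. *)
  rewrite odd_mul_tperm eq_sym ba -mulgA plen_mul_tperm 1?eq_sym //; last first.
    by apply: notin_porbit_fixed; rewrite 1?eq_sym // permM sa.
  rewrite exprS; move: (plen _) => k; case: (odd_perm s) => /=.
    by rewrite expr0 expr1 mul1r [RHS]mulrACA ee mul1r.
  by rewrite expr0 expr1 mul1r mulrA.
rewrite (eq_bigr _ step) -mulr_suml cS big_ord_recr /= mulrAC mulrC; congr (_ * _).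
rewrite (bigD1 a) //= eqxx; congr (_ + _).
rewrite (eq_bigr (fun=> e * q)) => [|b /andP[_ /negPf ->] //].
rewrite sumr_const -cS'.
have -> : #|[pred i in S | i != a]| = #|S :\ a|.
  by apply: eq_card => x; rewrite !inE andbC.
by rewrite -(mulr_natr (e * q)) mulrAC.
Qed.

Lemma perm_astabsC (T : finType) (S : {set T}) (s : {perm T}) :
  (s \in ('N(~: S | 'P))%g) = (s \in ('N(S | 'P))%g).
Proof.
by apply/perm_astabsP/perm_astabsP => h x; have := h x; rewrite ?inE; [move/negb_inj | move=> ->].
Qed.

Lemma perm_on_astabs (T : finType) (S : {set T}) (s : {perm T}) :
  perm_on S s -> s \in ('N(S | 'P))%g.
Proof. by move=> sS; apply/perm_astabsP => x; apply: perm_closed. Qed.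

Lemma restr_perm_id (T : finType) (S : {set T}) (s : {perm T}) :
  perm_on S s -> restr_perm S s = s.
Proof.
move=> sS; apply/permP => x; have [xS|xS] := boolP (x \in S).
  by rewrite restr_permE // perm_on_astabs.
by rewrite restr_perm_out // (out_perm sS).
Qed.

Lemma restr_perm_off (T : finType) (S : {set T}) (s : {perm T}) :
  perm_on (~: S) s -> restr_perm S s = 1%g.
Proof.
move=> sS; apply/permP => x; rewrite perm1; have [xS|xS] := boolP (x \in S).
  by rewrite restr_permE ?(out_perm sS) // -1?perm_astabsC ?perm_on_astabs // inE xS.
by rewrite restr_perm_out.
Qed.

Lemma restr_permM (T : finType) (S : {set T}) (s t : {perm T}) :
  s \in ('N(S | 'P))%g -> t \in ('N(S | 'P))%g ->
  restr_perm S (s * t)%g = (restr_perm S s * restr_perm S t)%g.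
Proof. by move=> sN tN; rewrite morphM. Qed.

Lemma restr_permC_mul (T : finType) (S : {set T}) (s : {perm T}) :
  s \in ('N(S | 'P))%g -> (restr_perm S s * restr_perm (~: S) s)%g = s.
Proof.
move=> sN; have sN' : s \in ('N(~: S | 'P))%g by rewrite perm_astabsC.
apply/permP => x; rewrite permM; have [xS|xS] := boolP (x \in S).
  rewrite [restr_perm S s x]restr_permE // restr_perm_out // inE negbK.
  by rewrite (perm_astabsP _ _ sN).
by rewrite [restr_perm S s x]restr_perm_out // restr_permE // inE.
Qed.

(** At [q = 1/N] and after multiplication by [N ^ m], this is the falling factorial of [N] of length
    [k] times the rising one of length [m - k]. *)
Definition stirling_prod (R : comPzRingType) (q : R) (m k : nat) : R :=
  \prod_(i < k) (1 - i%:R * q) * \prod_(i < m - k) (1 + i%:R * q).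

(** The stabilizer is the product of the permutations supported on [S] and those supported on its
    complement. Only the first kind carries the sign, which turns its factors [1 + i q] into
    [1 - i q]. *)
Lemma sum_astabs_sign_plen (R : comPzRingType) (T : finType) (q : R) (S : {set T}) :
  \sum_(s : {perm T} | s \in ('N(S | 'P))%g) (-1) ^+ restr_perm S s * q ^+ plen s
  = stirling_prod q #|T| #|S|.
Proof.
rewrite (reindex_onto (fun p : {perm T} * {perm T} => (p.1 * p.2)%g)
   (fun s => (restr_perm S s, restr_perm (~: S) s))) /=; last first.
  by move=> s sN; rewrite restr_permC_mul.
transitivity (\sum_(u : {perm T} | perm_on (~: S) u) \sum_(s | perm_on S s)
    (-1) ^+ s * q ^+ plen (s * u)%g).
  rewrite exchange_big pair_big_dep /=.
  apply: congr_big => // [[s u]|[s u]] /=.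
    apply/idP/idP => [/andP[_ /eqP[<- <-]]|/andP[sS uS]]; first by rewrite !restr_perm_on.
    have uS' : perm_on (~: ~: S) s by rewrite setCK.
    have sN := perm_on_astabs sS; have sN' : s \in ('N(~: S | 'P))%g by rewrite perm_astabsC.
    have uN' := perm_on_astabs uS; have uN : u \in ('N(S | 'P))%g by rewrite -perm_astabsC.
    by rewrite !restr_permM // groupM // (restr_perm_id sS) (restr_perm_id uS) (restr_perm_off uS)
      (restr_perm_off uS') mulg1 mul1g eqxx.
  by move=> /andP[_ /eqP[-> _]].
rewrite (eq_bigr (fun u => \prod_(i < #|S|) (1 - i%:R * q) * q ^+ plen u)); last first.
  move=> u uS; rewrite sum_perm_on_plen ?mulrNN ?mulr1 //.
  by congr (_ * _); apply: eq_bigr => i _; rewrite mulN1r mulNr.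
rewrite -mulr_sumr; congr (_ * _).
have -> : (#|T| - #|S|)%N = #|~: S| by rewrite -(cardsC S) addKn.
have plen1 : plen (1%g : {perm T}) = 0%N.
  apply/eqP; rewrite subn_eq0 card_imset // => x y /eqP; rewrite eq_porbit_mem => /porbitP[i ->].
  by rewrite expg1n perm1.
transitivity (\prod_(i < #|~: S|) (1 + 1 * i%:R * q) * q ^+ plen (1%g : {perm T})).
  rewrite -sum_perm_on_plen ?perm_on1 ?mulr1 //.
  by apply: eq_bigr => s _; rewrite expr1n mul1r mulg1.
by rewrite plen1 mulr1; apply: eq_bigr => i _; rewrite mul1r.
Qed.

Section FixedPointFreeInvolution.
Variables (T : finType) (nu : {perm T}).
Hypothesis nuK : forall x, nu (nu x) = x.
Hypothesis nu_fpf : forall x, nu x != x.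

Lemma involution_mulg : (nu * nu = 1)%g.
Proof. by apply/permP => x; rewrite permM nuK perm1. Qed.

Lemma porbit_involution x : porbit nu x = [set x; nu x].
Proof.
apply/setP => y; rewrite !inE; apply/porbitP/orP => [[i ->]|[/eqP->|/eqP->]].
- elim: i => [|i [/eqP E|/eqP E]]; first by left; rewrite perm1.
    by right; rewrite expgSr permM E.
  by left; rewrite expgSr permM E nuK.
- by exists 0%N; rewrite perm1.
- by exists 1%N; rewrite expg1.
Qed.

Lemma card_porbit_involution x : #|porbit nu x| = 2.
Proof. by rewrite porbit_involution cards2 eq_sym nu_fpf. Qed.

Lemma card_cover_involution (P : {set {set T}}) :
  P \subset porbits nu -> #|cover P| = (2 * #|P|)%N.
Proof.
move=> sP.
have triv : trivIset P.
  apply/trivIsetP => A B AP BP.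
  have /imsetP[x _ ->] := subsetP sP _ AP; have /imsetP[y _ ->] := subsetP sP _ BP.
  apply: contraR => /pred0Pn[z] /= /andP[].
  by rewrite -!eq_porbit_mem => /eqP <- /eqP <-.
rewrite -(eqP triv) (eq_bigr (fun=> 2)) => [|A /(subsetP sP) /imsetP[x _ ->]].
  by rewrite sum_nat_const mulnC.
exact: card_porbit_involution.
Qed.

Lemma card_involution : #|T| = (2 * #|porbits nu|)%N.
Proof.
rewrite -card_cover_involution // -cardsT; congr #|pred_of_set _|.
by apply/setP => x; rewrite inE (mem_cover_porbits _ (subxx _)) imset_f.
Qed.

Definition defect (S : {set T}) : {set T} := [set x in S | nu x \notin S].

Lemma defect_eq0 (S : {set T}) : (defect S == set0) = (nu \in ('N(S | 'P))%g).
Proof.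
apply/eqP/perm_astabsP => [D0 x|h]; last first.
  by apply/setP => x; rewrite !inE h andbN.
have st y : y \in S -> nu y \in S.
  by move=> yS; apply: contraT => nyS; have := in_set0 y; rewrite -D0 inE yS nyS.
by apply/idP/idP => [/st|/st //]; rewrite nuK.
Qed.

Section Stabilizer.
Variables (R : numDomainType) (q : R).

Definition stab_sum (S : {set T}) : R :=
  \sum_(s : {perm T} | s \in ('N(S | 'P))%g) (-1) ^+ restr_perm S s * q ^+ plen (nu * s)%g.

(** Replace [s] by [t * s * t'], where [t] exchanges [a] and [a'] inside [S] and [t'] exchanges
    their partners outside. Since [nu * t = t' * nu], the product [nu * s] is merely conjugated by
    [t'], while the sign on [S] changes. *)
Lemma stab_sum_eq0 (S : {set T}) a a' :
  a != a' -> a \in defect S -> a' \in defect S -> stab_sum S = 0.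
Proof.
rewrite !inE => aa' /andP[aS naS] /andP[a'S na'S].
set t := tperm a a'; set t' := tperm (nu a) (nu a').
have tS : perm_on S t.
  apply/subsetP => x; rewrite inE; have [->//|xa] := eqVneq x a.
  by have [->//|xa'] := eqVneq x a'; rewrite tpermD ?eqxx // eq_sym.
have t'S : perm_on (~: S) t'.
  apply/subsetP => x; rewrite !inE; have [->//|xa] := eqVneq x (nu a).
  by have [->//|xa'] := eqVneq x (nu a'); rewrite tpermD ?eqxx // eq_sym.
have tN : t \in ('N(S | 'P))%g := perm_on_astabs tS.
have t'N : t' \in ('N(S | 'P))%g by rewrite -perm_astabsC perm_on_astabs.
have ntn : (nu * t = t' * nu)%g.
  apply/permP => x; rewrite !permM /t /t'.
  have [->|xa] := eqVneq x (nu a); first by rewrite nuK !tpermL nuK.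
  have [->|xa'] := eqVneq x (nu a'); first by rewrite nuK !tpermR nuK.
  rewrite !tpermD // 1?eq_sym //.
    by apply: contraNneq xa => <-; rewrite nuK.
  by apply: contraNneq xa' => <-; rewrite nuK.
suff E : stab_sum S = - stab_sum S.
  by apply/eqP; rewrite -[_ == 0](mulrn_eq0 (stab_sum S) 2) mulr2n {1}E addNr.
rewrite {1}/stab_sum (reindex_inj (mulgI t)) (reindex_inj (mulIg t')) -sumrN /=.
apply: congr_big => // [s|s]; first by rewrite groupMl // groupMr.
rewrite groupMl // groupMr // => sN.
rewrite !restr_permM ?groupM // (restr_perm_id tS) (restr_perm_off t'S) mulg1.
rewrite odd_mul_tperm aa' -mulNr; congr (_ * _).
  by case: odd_perm; rewrite ?expr0 ?expr1 ?opprK.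
by rewrite -(plenJ (nu * s) t') conjgE tpermV !mulgA ntn.
Qed.

(** Here [nu] lies in the stabilizer, so the substitution of [nu * s] for [s] removes it from the
    exponent. *)
Lemma stab_sum_stable (S : {set T}) : nu \in ('N(S | 'P))%g ->
  stab_sum S = (-1) ^+ restr_perm S nu * stirling_prod q #|T| #|S|.
Proof.
move=> nuN; rewrite -sum_astabs_sign_plen mulr_sumr /stab_sum.
rewrite (reindex_inj (mulgI nu)) /=; apply: congr_big => // [s|s].
  by rewrite groupMl.
rewrite groupMl // => sN; rewrite restr_permM // mulgA involution_mulg mul1g.
by rewrite mulrA -signr_addb -odd_permM.
Qed.

Lemma defect1_perm_on (S : {set T}) a : defect S = [set a] ->
  [/\ a \in S, nu a \notin S, (nu * tperm a (nu a))%g \in ('N(S | 'P))%g &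
      nu \in ('N(S :\ a | 'P))%g].
Proof.
move=> Da; have : a \in defect S by rewrite Da inE.
rewrite inE => /andP[aS naS].
have st x : x \in S -> x != a -> nu x \in S.
  move=> xS xa; apply: contraNT xa => nxS.
  by rewrite -[x == a]in_set1 -Da inE xS.
have st' x : x \notin S -> x != nu a -> nu x \notin S.
  move=> xS xa; apply: contra xS => nxS; rewrite -(nuK x); apply: st => //.
  by apply: contraNneq xa => <-; rewrite nuK.
split=> //; apply/perm_astabsP => x.
  rewrite permM; have [->|xa] := eqVneq x a; first by rewrite tpermR aS.
  have [->|xb] := eqVneq x (nu a); first by rewrite nuK tpermL (negPf naS).
  rewrite tpermD; first by apply/idP/idP => [|/st->//]; apply: contraTT => /st'->.
    by apply: contraNneq xb => ->; rewrite nuK.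
  by rewrite (inj_eq perm_inj) eq_sym.
rewrite !inE; have [->|xa] := eqVneq x a; first by rewrite (negPf naS) andbF.
have [->|xb] := eqVneq x (nu a); first by rewrite nuK eqxx (negPf naS).
rewrite andTb; have -> /= : nu x != a by apply: contraNneq xb => <-; rewrite nuK.
by apply/idP/idP => [|/st->//]; apply: contraTT => /st'->.
Qed.

(** [nu'] is [nu] with the chord at [a] cut into two fixed points; it stabilizes [S] and is absorbed
    by a substitution. The remaining transposition joins a cycle inside [S] to one outside, which
    costs one factor [q]. *)
Lemma stab_sum_defect1 (S : {set T}) a : defect S = [set a] ->
  stab_sum S = q * ((-1) ^+ restr_perm (S :\ a) nu * stirling_prod q #|T| #|S|).
Proof.
move=> Da; have [aS naS nu'N nuN] := defect1_perm_on Da.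
set t := tperm a (nu a); set nu' := (nu * t)%g.
have tnu : (t * nu' = nu)%g.
  apply/permP => x; rewrite !permM /t.
  have [->|xa] := eqVneq x a; first by rewrite tpermL nuK tpermL.
  have [->|xb] := eqVneq x (nu a); first by rewrite tpermR tpermR nuK.
  rewrite (tpermD (z := x)) 1?[_ == x]eq_sym // tpermD // 1?[nu a == _](inj_eq perm_inj) 1?eq_sym //.
  by apply: contraNneq xb => <-; rewrite nuK.
have -> : restr_perm (S :\ a) nu = restr_perm S nu'.
  apply/permP => x; have [xS|xS] := boolP (x \in S); last first.
    by rewrite !restr_perm_out // !inE (negPf xS) andbF.
  rewrite [RHS]restr_permE // permM /t; have [->|xa] := eqVneq x a.
    by rewrite restr_perm_out ?tpermR // !inE eqxx.
  rewrite restr_permE // ?inE ?xa // tpermD //; last by rewrite (inj_eq perm_inj) eq_sym.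
  by apply: contraNneq naS => ->; rewrite nuK.
rewrite -sum_astabs_sign_plen !mulr_sumr /stab_sum.
rewrite [RHS](reindex_inj (mulgI nu')) /=; apply: congr_big => // [s|s sN].
  by rewrite groupMl.
rewrite (restr_permM nu'N sN) odd_permM signr_addb -{1}tnu -/t -/nu' -mulgA plen_mul_tperm.
- by rewrite exprS mulrCA -[in RHS]mulrA signrMK.
- by rewrite eq_sym nu_fpf.
rewrite porbit_sym; apply: contraL aS => h.
by rewrite -(astabs_porbit _ h) // groupM.
Qed.

End Stabilizer.
End FixedPointFreeInvolution.

Section LongCycleSum.
Variables (T : finType) (nu : {perm T}).
Hypothesis nuK : forall x, nu (nu x) = x.
Hypothesis nu_fpf : forall x, nu x != x.
Variables (R : numDomainType) (q : R) (p : T) (n : nat).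
Hypothesis cardT : #|T| = (2 * n.+1)%N.

Lemma card_porbits_no_p : #|porbits nu :\ porbit nu p| = n.
Proof.
have := card_involution nuK nu_fpf; rewrite cardT (cardsD1 (porbit nu p)) imset_f //.
by lia.
Qed.

Lemma sum_stable_sign (h : nat -> R) :
  \sum_(S : {set T} | (nu \in ('N(S | 'P))%g) && (p \notin S))
     (-1) ^+ #|S| * ((-1) ^+ restr_perm S nu * h #|S|)
  = \sum_(j < n.+1) (-1) ^+ j * 'C(n, j)%:R * h (2 * j)%N.
Proof.
rewrite sum_astabs; transitivity
  (\sum_(P in powerset (porbits nu :\ porbit nu p)) (fun j => (-1) ^+ j * h (2 * j)%N) #|P|).
  apply: eq_bigr => P; rewrite powersetE subsetD1 => /andP[sP _].
  rewrite mulrA restr_perm_sign ?cover_porbits_astabs // imset_porbit_cover //.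
  by rewrite (card_cover_involution nuK nu_fpf).
rewrite (sum_powerset_card _ (fun j => (-1) ^+ j * h (2 * j)%N)) card_porbits_no_p.
by apply: eq_bigr => j _; rewrite -[LHS]mulr_natr mulrAC.
Qed.

Lemma defect_setU1 (S : {set T}) a :
  (nu \in ('N(S | 'P))%g) && (a \notin S) = (defect nu (a |: S) == [set a]) && (a \notin S).
Proof.
have [aS|aS] := boolP (a \in S); rewrite /= ?andbF ?andbT //.
apply/idP/eqP => [/perm_astabsP nN|Da].
  apply/setP => x; rewrite !inE nN negb_or; have [->|xa] := eqVneq x a.
    by rewrite nu_fpf aS.
  by case: (x \in S); rewrite ?andbF.
by have [_ _ _] := defect1_perm_on nuK Da; rewrite setU1K.
Qed.

(* Expand the indicator of long cycles over invariant sets [S] avoiding [p]; only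
   the [S] which are [nu]-stable up to at most one point contribute. *)
Lemma sum_long_cycle_plen :
  \sum_(s : {perm T} | #|porbits s| == 1%N) q ^+ plen (nu * s)%g
  = \sum_(j < n.+1) (-1) ^+ j * 'C(n, j)%:R *
     (stirling_prod q #|T| (2 * j)
      - (2 * (n - j) + 1)%:R * q * stirling_prod q #|T| (2 * j).+1).
Proof.
pose X (S : {set T}) := (-1) ^+ #|S| * stab_sum nu q S.
transitivity (\sum_(S : {set T} | p \notin S) X S).
  rewrite big_mkcond /=.
  transitivity (\sum_(s : {perm T}) \sum_(S : {set T} | (s \in ('N(S | 'P))%g) && (p \notin S))
     (-1) ^+ #|S| * (-1) ^+ restr_perm S s * q ^+ plen (nu * s)%g).
    apply: eq_bigr => s _; rewrite -mulr_suml long_cycle_sign_sum.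
    by case: eqP; rewrite ?mul1r ?mul0r.
  rewrite (exchange_big_dep (fun S : {set T} => p \notin S)) /=; last by move=> s S _ /andP[].
  apply: eq_bigr => S pS; rewrite /X /stab_sum mulr_sumr.
  by apply: eq_big => [s|s _]; rewrite ?pS ?andbT // mulrA.
transitivity (\sum_(S : {set T} | (nu \in ('N(S | 'P))%g) && (p \notin S)) X S
    + \sum_a \sum_(S : {set T} | (defect nu S == [set a]) && (p \notin S)) X S).
  rewrite (bigID (fun S : {set T} => nu \in ('N(S | 'P))%g)) /=; congr (_ + _).
    by apply: eq_bigl => S; rewrite andbC.
  rewrite (exchange_big_dep (fun S : {set T} => p \notin S)) /=; last by move=> a S _ /andP[].
  rewrite [LHS]big_mkcondr /=; apply: eq_bigr => S pS.
  rewrite -defect_eq0 //; have [->|[a aD]] := set_0Vmem (defect nu S).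
    by rewrite eqxx /= big1 // => a /andP[/eqP/setP/(_ a)]; rewrite !inE eqxx.
  have -> /= : (defect nu S != set0) by apply/set0Pn; exists a.
  have [/eqP ED|] := boolP (defect nu S == [set a]).
    by rewrite (big_pred1 a) // => b; rewrite pS andbT ED (inj_eq set1_inj) eq_sym.
  rewrite eqEsubset sub1set aD andbT => /subsetPn[b bD]; rewrite inE => ba.
  rewrite /X (stab_sum_eq0 nuK q ba bD aD) mulr0 big_pred0 // => c.
  apply/negbTE/negP => /andP[/eqP/setP D _].
  by move: bD aD ba; rewrite !D !inE => /eqP -> /eqP ->; rewrite eqxx.
have -> : \sum_(S : {set T} | (nu \in ('N(S | 'P))%g) && (p \notin S)) X S
  = \sum_(j < n.+1) (-1) ^+ j * 'C(n, j)%:R * stirling_prod q #|T| (2 * j).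
  rewrite -(sum_stable_sign (fun k => stirling_prod q #|T| k)).
  by apply: eq_bigr => S /andP[nN _]; rewrite /X stab_sum_stable.
(* A set with defect [[set a]] is a stable set with the point [a] added; the added point changes the
   parity of the size, whence [- q]. *)
have -> : \sum_a \sum_(S : {set T} | (defect nu S == [set a]) && (p \notin S)) X S
  = \sum_(a | a != p) \sum_(S : {set T} | ((nu \in ('N(S | 'P))%g) && (p \notin S)) && (a \notin S))
      (-1) ^+ #|S| * ((-1) ^+ restr_perm S nu * (- q * stirling_prod q #|T| #|S|.+1)).
  rewrite [RHS]big_mkcond /=; apply: eq_bigr => a _.
  have [->|ap] /= := eqVneq a p.
    rewrite big_pred0 // => S; apply/negbTE/negP => /andP[/eqP D].
    by case/negP; have [] := defect1_perm_on nuK D.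
  rewrite (reindex_onto (fun S : {set T} => a |: S) (fun S => S :\ a)) /=; last first.
    move=> S /andP[/eqP D _]; rewrite setD1K //.
    by have [] := defect1_perm_on nuK D.
  apply: congr_big => // [S|S].
    have aE : ((a |: S) :\ a == S) = (a \notin S).
      by apply/eqP/idP => [<-|/setU1K //]; rewrite setD11.
    rewrite aE -!andbA [(p \notin S) && _]andbC !andbA defect_setU1.
    by rewrite !inE negb_or (eq_sym p) ap /= andbAC.
  move=> /andP[/andP[/eqP D _] /eqP E].
  have aS : a \notin S by rewrite -E setD11.
  rewrite /X (stab_sum_defect1 nuK nu_fpf q D) cardsU1 aS setU1K //=.
  by rewrite add1n exprS mulN1r !mulNr !mulrN; congr (- (_ * _)); rewrite mulrCA.
rewrite (exchange_big_dep (fun S : {set T} => (nu \in ('N(S | 'P))%g) && (p \notin S))) /=;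
  last by move=> a S _ /andP[].
(* For a stable [S] of size [2 * j] the added point ranges over the complement of [p |: S], which
   has [2 * (n - j) + 1] elements. *)
transitivity (\sum_(j < n.+1) (-1) ^+ j * 'C(n, j)%:R * stirling_prod q #|T| (2 * j)
  + \sum_(S : {set T} | (nu \in ('N(S | 'P))%g) && (p \notin S))
     (-1) ^+ #|S| * ((-1) ^+ restr_perm S nu *
       (fun k => - q * stirling_prod q #|T| k.+1 *+ (#|T| - k.+1)) #|S|)).
  congr (_ + _); apply: eq_bigr => S /andP[nN pS].
  rewrite sumr_const /= !mulrnAr; congr (_ *+ _).
  have -> : (#|T| - #|S|.+1)%N = #|~: (p |: S)|.
    by rewrite -(cardsC (p |: S)) cardsU1 pS addKn.
  by apply: eq_card => a; rewrite unfold_in /= nN pS !inE negb_or.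
rewrite (sum_stable_sign (fun k => - q * stirling_prod q #|T| k.+1 *+ (#|T| - k.+1))).
rewrite -big_split /=; apply: eq_bigr => j _; rewrite -mulrDr; congr (_ * (_ + _)).
rewrite cardT mulNr mulNrn -[X in - X = _]mulr_natl mulrA; congr (- (_%:R * _ * _)).
by have := ltn_ord j; lia.
Qed.

End LongCycleSum.

(** * Averaging over long cycles *)

Lemma fpf_involutionP m (s : {perm 'I_m}) :
  reflect ((forall x, s (s x) = x) /\ (forall x, s x != x)) (fpf_involution s).
Proof.
apply: (iffP andP) => [[/eqP ss /forallP sx]|[sK sx]]; split=> //.
- by move=> x; rewrite -permM ss perm1.
- by apply/eqP/permP => x; rewrite permM sK perm1.
exact/forallP.
Qed.

Lemma fpf_involutionJ m (s t : {perm 'I_m}) : fpf_involution (s ^ t)%g = fpf_involution s.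
Proof.
apply/fpf_involutionP/fpf_involutionP => -[sK sx]; split=> x.
- by have := sK (t x); rewrite !permJ => /perm_inj.
- by have := sx (t x); rewrite !permJ (inj_eq perm_inj).
- by rewrite -(permKV t x) !permJ sK.
- by rewrite -(permKV t x) !permJ (inj_eq perm_inj).
Qed.

Lemma tauE c m (i : 'I_m) : tau c m i = tauf c m i :> nat.
Proof. by rewrite permE val_insubd tauf_lt. Qed.

Lemma tau_full_ltn m (i : 'I_m) : (i.+1 < m)%N -> tau m m i = i.+1 :> nat.
Proof. by move=> im; rewrite tauE /tauf minnn; case: eqP => //; lia. Qed.

Lemma tau_full_last m (i : 'I_m) : i.+1 = m -> tau m m i = 0%N :> nat.
Proof. by move=> im; rewrite tauE /tauf minnn im eqxx. Qed.

(* The conjugating permutation is [i |-> s^i p] for an arbitrary point [p]. *)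
Lemma long_cycle_conj m (s : {perm 'I_m.+1}) :
  #|porbits s| = 1%N -> exists t, (tau m.+1 m.+1 ^ t)%g = s.
Proof.
move=> s1.
have sx : #|porbit s ord0| = m.+1.
  rewrite -[RHS]card_ord; apply/eqP; rewrite eqn_leq max_card /=.
  apply/subset_leq_card/subsetP => y _; rewrite -eq_porbit_mem.
  move/eqP/cards1P: s1 => [B EB].
  have : porbit s y \in porbits s by apply: imset_f.
  have : porbit s ord0 \in porbits s by apply: imset_f.
  by rewrite EB !inE => /eqP -> /eqP ->.
have inj : injective (fun i : 'I_m.+1 => iter i s ord0).
  move=> i j E; apply: val_inj; apply/eqP.
  have := uniq_traject_porbit s ord0; rewrite sx => U.
  rewrite -(nth_uniq ord0 _ _ U) ?size_traject ?ltn_ord //.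
  by rewrite !nth_traject ?ltn_ord // E.
exists (perm inj); apply/permP => x.
rewrite -(permKV (perm inj) x); move: ((perm inj)^-1 x)%g => i.
rewrite permJ !(permE inj) /=; move: (ltn_ord i); rewrite ltnS leq_eqVlt => /orP[/eqP im|im].
  rewrite tau_full_last ?im //= -iterS.
  by have := iter_porbit s ord0; rewrite sx.
by rewrite tau_full_ltn.
Qed.

Lemma stirling_prod1 (m k : nat) :
  stirling_prod (1 : rat) m k = (k <= 1)%:R * ((m - k)`!)%:R.
Proof.
rewrite /stirling_prod; congr (_ * _).
  case: k => [|[|k]]; rewrite ?big_ord0 //.
    by rewrite big_ord_recl big_ord0 mul0r subr0 mulr1.
  by rewrite !big_ord_recl /= !mulr1 [1 - 1]subrr mul0r mulr0.
elim: (m - k)%N => [|n IH]; first by rewrite big_ord0.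
by rewrite big_ord_recr /= IH factS natrM mulr1 -natr1 addrC mulrC.
Qed.

(** Double counting of pairs of a pairing and a long cycle: the long cycles are conjugate and
    conjugation permutes the pairings, so every long cycle contributes as much as [tau]. *)
Lemma sum_fpf_plen (n : nat) (q : rat) :
  ((2 * n).+1`!)%:R * \sum_(s : {perm 'I_(2 * n.+1)} | fpf_involution s)
      q ^+ plen (s * tau (2 * n.+1) (2 * n.+1))%g
  = #|[set s : {perm 'I_(2 * n.+1)} | fpf_involution s]|%:R *
    \sum_(j < n.+1) (-1) ^+ j * 'C(n, j)%:R *
     (stirling_prod q (2 * n.+1) (2 * j)
      - (2 * (n - j) + 1)%:R * q * stirling_prod q (2 * n.+1) (2 * j).+1).
Proof.
have mE : (2 * n.+1 = (2 * n).+2)%N by lia.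
pose F (q : rat) := \sum_(j < n.+1) (-1) ^+ j * 'C(n, j)%:R *
     (stirling_prod q (2 * n.+1) (2 * j)
      - (2 * (n - j) + 1)%:R * q * stirling_prod q (2 * n.+1) (2 * j).+1).
(* At [q = 1] the closed form counts the long cycles themselves; only [j = 0] contributes. *)
have F1 : F 1 = ((2 * n).+1`!)%:R.
  rewrite /F big_ord_recl big1 => [|j _]; last first.
    rewrite !stirling_prod1 lift0 (_ : (2 * j.+1 <= 1)%N = false); last by lia.
    by rewrite (_ : (_ <= 1)%N = false) ?mul0r ?mulr0 ?subr0 ?mulr0 //; lia.
  rewrite !stirling_prod1 /= muln0 !subn0 expr0 bin0 !mulr1 !mul1r addr0.
  have -> : (2 * n.+1 - 1 = (2 * n).+1)%N by lia.
  by rewrite mE factS natrM -mulrBl addn1 -[in X in X - _]natr1 addrAC subrr add0r mul1r.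
rewrite -/(F q).
have FE (s : {perm 'I_(2 * n.+1)}) (q' : rat) : fpf_involution s ->
    \sum_(t : {perm 'I_(2 * n.+1)} | #|porbits t| == 1%N) q' ^+ plen (s * t)%g = F q'.
  move=> /fpf_involutionP[sK sx].
  have := @sum_long_cycle_plen _ s sK sx _ q' (cast_ord (esym mE) ord0) n.
  by rewrite card_ord => ->.
(* One pairing is enough to read off the number of long cycles as [F 1]; if there were none, both
   sides would vanish. *)
have [s0 s0f|no] := pickP (fun s : {perm 'I_(2 * n.+1)} => fpf_involution s); last first.
  rewrite big_pred0 // mulr0 (_ : [set s | _] = set0) ?cards0 ?mul0r //.
  by apply/setP => s; rewrite !inE no.
transitivity (\sum_(s : {perm 'I_(2 * n.+1)} | fpf_involution s)
   \sum_(t : {perm 'I_(2 * n.+1)} | #|porbits t| == 1%N) q ^+ plen (s * t)%g); last first.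
  by rewrite (eq_bigr _ (fun s sf => FE s q sf)) sumr_const mulr_natl cardsE.
rewrite exchange_big /= -F1 -(FE s0 1 s0f) mulr_suml; apply: eq_bigr => t /eqP t1.
rewrite expr1n mul1r.
have [g <-] : exists g, (tau (2 * n.+1) (2 * n.+1) ^ g)%g = t.
  by move: t t1; rewrite mE => t; apply: long_cycle_conj.
rewrite [RHS](reindex_inj (conjg_inj g)) /=; apply: eq_big => [s|s _].
  by rewrite fpf_involutionJ.
by rewrite -conjMg plenJ.
Qed.

(** * Inserting a chord *)

Lemma lift_perm_fixed n (i : 'I_n.+1) (u : {perm 'I_n.+1}) :
  u i = i -> exists v, u = lift_perm i i v.
Proof.
move=> ui; pose f (j : 'I_n) : 'I_n := odflt j (unlift i (u (lift i j))).
have fE j : lift i (f j) = u (lift i j).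
  rewrite /f; case: unliftP => [j' -> //|E].
  by have := neq_lift i j; rewrite -(inj_eq (@perm_inj _ u)) ui E eqxx.
have f_inj : injective f.
  by move=> j j' E; apply: (@lift_inj _ i); apply: (@perm_inj _ u); rewrite -!fE E.
exists (perm f_inj); apply/permP => x; case: (unliftP i x) => [j ->|->].
  by rewrite lift_perm_lift permE fE.
by rewrite lift_perm_id.
Qed.

Lemma lift_perm_inj n (i j : 'I_n.+1) : injective (lift_perm i j).
Proof.
move=> s t E; apply/permP => x; apply: (@lift_inj _ j).
by rewrite -!(lift_perm_lift i) E.
Qed.

Lemma ncycles_lift_perm n (i : 'I_n.+1) (s : {perm 'I_n}) :
  ncycles (lift_perm i i s) = (ncycles s).+1.
Proof.
have liftX k : (lift_perm i i s ^+ k)%g = lift_perm i i (s ^+ k)%g.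
  by elim: k => [|k IH]; rewrite ?expg0 ?lift_perm1 // !expgSr IH lift_permM.
have Ei : porbit (lift_perm i i s) i = [set i].
  apply/setP => x; rewrite inE; apply/porbitP/eqP => [[k ->]|->].
    by rewrite liftX lift_perm_id.
  by exists 0%N; rewrite perm1.
have El j : porbit (lift_perm i i s) (lift i j) = lift i @: porbit s j.
  apply/setP => x; apply/porbitP/imsetP => [[k ->]|[y /porbitP[k ->] ->]].
    by exists ((s ^+ k)%g j); rewrite ?mem_porbit // liftX lift_perm_lift.
  by exists k; rewrite liftX lift_perm_lift.
rewrite /ncycles (_ : porbits (lift_perm i i s)
  = [set i] |: ((fun A : {set 'I_n} => lift i @: A) @: porbits s)).
  rewrite cardsU1 card_imset; last exact/imset_inj/lift_inj.
  rewrite (_ : (_ \notin _) = true) //; apply/imsetP => -[A _ E].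
  have : i \in lift i @: A by rewrite -E inE.
  by case/imsetP => x _ /eqP; rewrite (negPf (neq_lift i x)).
apply/setP => A; rewrite in_setU1; apply/imsetP/orP => [[x _ ->]|[/eqP ->|]].
- case: (unliftP i x) => [j ->|->]; last by left; rewrite Ei.
  by right; rewrite El; apply: imset_f; apply: imset_f.
- by exists i; rewrite ?Ei.
by case/imsetP => _ /imsetP[j _ ->] ->; exists (lift i j); rewrite ?El.
Qed.

(* The new chord joins a new first point to a new point at position [k.+1]. *)
Definition ins_chord m (k : 'I_m.+1) (s : {perm 'I_m}) : {perm 'I_m.+2} :=
  (lift_perm ord0 ord0 (lift_perm k k s) * tperm ord0 (lift ord0 k))%g.

Lemma ins_chord0 m (k : 'I_m.+1) (s : {perm 'I_m}) : ins_chord k s ord0 = lift ord0 k.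
Proof. by rewrite permM lift_perm_id tpermL. Qed.

Lemma ins_chordk m (k : 'I_m.+1) (s : {perm 'I_m}) : ins_chord k s (lift ord0 k) = ord0.
Proof. by rewrite permM lift_perm_lift lift_perm_id tpermR. Qed.

Lemma ins_chord_lift m (k : 'I_m.+1) (s : {perm 'I_m}) j :
  ins_chord k s (lift ord0 (lift k j)) = lift ord0 (lift k (s j)).
Proof.
by rewrite permM !lift_perm_lift tpermD ?(inj_eq lift_inj) ?neq_lift.
Qed.

Lemma ins_chord_cases m (k : 'I_m.+1) (x : 'I_m.+2) :
  [\/ x = ord0, x = lift ord0 k | exists j, x = lift ord0 (lift k j)].
Proof.
case: (unliftP ord0 x) => [y ->|->]; last by constructor 1.
by case: (unliftP k y) => [j ->|->]; [constructor 3; exists j|constructor 2].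
Qed.

Lemma fpf_ins_chord m (k : 'I_m.+1) (s : {perm 'I_m}) :
  fpf_involution (ins_chord k s) = fpf_involution s.
Proof.
apply/fpf_involutionP/fpf_involutionP => -[sK sx]; split=> x.
- by have := sK (lift ord0 (lift k x)); rewrite !ins_chord_lift => /lift_inj/lift_inj.
- by have := sx (lift ord0 (lift k x)); rewrite ins_chord_lift !(inj_eq lift_inj).
- have [->|->|[j ->]] := ins_chord_cases k x; rewrite ?ins_chord0 ?ins_chordk ?ins_chord0 //.
  by rewrite !ins_chord_lift sK.
have [->|->|[j ->]] := ins_chord_cases k x.
- by rewrite ins_chord0 eq_sym neq_lift.
- by rewrite ins_chordk neq_lift.
by rewrite ins_chord_lift !(inj_eq lift_inj).
Qed.

Lemma ins_chord_inj m (k k' : 'I_m.+1) (s s' : {perm 'I_m}) :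
  ins_chord k s = ins_chord k' s' -> k = k' /\ s = s'.
Proof.
move=> E; have kk' : k = k'.
  by apply: (@lift_inj _ ord0); rewrite -(ins_chord0 k s) E ins_chord0.
by split=> //; move: E; rewrite kk' => /mulIg/lift_perm_inj/lift_perm_inj.
Qed.

Lemma fpf_is_ins_chord m (u : {perm 'I_m.+2}) :
  fpf_involution u -> exists k s, u = ins_chord k s.
Proof.
move=> /fpf_involutionP[uK ux].
case: (unliftP ord0 (u ord0)) => [k Ek|/eqP]; last by rewrite (negPf (ux _)).
set w := (u * tperm ord0 (lift ord0 k))%g.
have w0 : w ord0 = ord0 by rewrite permM Ek tpermR.
have [v Ev] := lift_perm_fixed w0.
have vk : v k = k.
  by apply: (@lift_inj _ ord0); rewrite -(lift_perm_lift ord0) -Ev permM -Ek uK tpermL.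
have [s Es] := lift_perm_fixed vk.
by exists k, s; rewrite /ins_chord -Es -Ev -mulgA tperm2 mulg1.
Qed.

Lemma sum_ins_chord (R : nmodType) m (h : {perm 'I_m.+2} -> R) :
  \sum_(u | fpf_involution u) h u
  = \sum_(k < m.+1) \sum_(s | fpf_involution s) h (ins_chord k s).
Proof.
rewrite pair_big_dep /=; pose f (p : 'I_m.+1 * {perm 'I_m}) := ins_chord p.1 p.2.
have -> : \sum_(u | fpf_involution u) h u
    = \sum_(u in f @: [set p | fpf_involution p.2]) h u.
  apply: eq_bigl => u; apply/idP/imsetP => [uf|[[k s]]].
    have [k [s E]] := fpf_is_ins_chord uf; exists (k, s) => //.
    by rewrite inE /= -(fpf_ins_chord k) -E.
  by rewrite inE /= => sf ->; rewrite fpf_ins_chord.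
rewrite big_imset /=; last by move=> [k s] [k' s'] _ _ /ins_chord_inj[/= <- <-].
by apply: eq_bigl => p; rewrite inE.
Qed.

Lemma val_tperm m (x y z : 'I_m) :
  tperm x y z = (if z == x :> nat then y : nat else if z == y :> nat then x : nat else z) :> nat.
Proof.
rewrite !val_eqE; case: tpermP => [->|->|/eqP/negPf-> /eqP/negPf->] //; rewrite eqxx //.
by case: eqP => [->|].
Qed.

Lemma ncycles_mul_tperm_fixed m (s : {perm 'I_m}) a b :
  s a = a -> (ncycles (s * tperm a b)%g + (a != b))%N = ncycles s.
Proof.
move=> sa; have -> : ncycles (s * tperm a b)%g = ncycles (tperm a b * s)%g.
  rewrite /ncycles -(card_porbitsJ (tperm a b * s) (tperm a b)).
  by rewrite conjgE tpermV !mulgA tperm2 mul1g.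
have [->|ab] := eqVneq a b; first by rewrite tperm1 mul1g addn0.
by rewrite addn1 /ncycles -card_porbits_tperm // notin_porbit_fixed.
Qed.

(* In the product with the full cycle, the two ends of the inserted chord become
   fixed points exactly when the corresponding backbone is empty. *)
Lemma ncycles_ins_chord m (k : 'I_m.+1) (s : {perm 'I_m}) :
  ncycles (ins_chord k s * tau m.+2 m.+2)%g
  = (ncycles (s * tau k m)%g + (k == 0 :> nat) + (k == m :> nat))%N.
Proof.
pose L (t : {perm 'I_m}) := lift_perm ord0 ord0 (lift_perm k k t).
(* The end [ord0] of the new chord enters a cycle just before [z], the first point of the second
   piece, and the other end just before [o1], the first point of the first piece. For an empty piece
   the transposition must be trivial, hence the value 0 when [k = m]. *)
pose z : 'I_m.+2 := inord (if k == m :> nat then 0%N else k.+2).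
have zE : z = (if k == m :> nat then 0%N else k.+2) :> nat.
  by rewrite inordK //; case: eqP => // km; have := ltn_ord k; lia.
pose o1 : 'I_m.+2 := lift ord0 ord0.
have E : (tperm ord0 (lift ord0 k) * tau m.+2 m.+2
          = L (tau k m) * tperm ord0 z * tperm (lift ord0 k) o1)%g.
  apply/permP => x; apply: val_inj; rewrite !permM /= tauE /tauf minnn.
  have kM := ltn_ord k.
  have [->|->|[j ->]] := ins_chord_cases k x.
  - rewrite lift_perm_id tpermL (val_tperm _ _ (tperm _ _ _)) tpermL zE /o1 !lift0 /=.
    by do ! case: eqP; lia.
  - rewrite lift_perm_lift lift_perm_id tpermR.
    rewrite !(val_tperm _ _ (tperm _ _ _)) !val_tperm zE /o1 !lift0 /=.
    by do ! case: eqP; lia.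
  rewrite tpermD ?(inj_eq lift_inj) ?neq_lift //.
  rewrite !lift_perm_lift !val_tperm zE /o1 !lift0 /= /bump tauE /tauf.
  by have := ltn_ord j; do ! case: eqP; lia.
have -> : (ins_chord k s * tau m.+2 m.+2
           = L (s * tau k m) * tperm ord0 z * tperm (lift ord0 k) o1)%g.
  by rewrite /ins_chord -mulgA E !mulgA /L !lift_permM.
have H1 := @ncycles_mul_tperm_fixed _ (L (s * tau k m) * tperm ord0 z)%g (lift ord0 k) o1.
have H2 := @ncycles_mul_tperm_fixed _ (L (s * tau k m)%g) ord0 z (lift_perm_id _ _ _).
rewrite permM lift_perm_lift lift_perm_id tpermD ?neq_lift // in H1; last first.
  by rewrite -val_eqE /= zE /bump /=; case: ifP; lia.
have := H1 erefl; move: H2; rewrite !ncycles_lift_perm -!val_eqE /= zE /bump /=.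
by move: (ncycles _) (ncycles _) (ncycles _) => a b c; do ! case: eqP; lia.
Qed.

(** * Disjoint unions of diagrams *)

Section PermSum.
Variables a b : nat.
Implicit Types (s : {perm 'I_a}) (t : {perm 'I_b}).

Definition psum_fun s t (x : 'I_(a + b)) : 'I_(a + b) :=
  match split x with inl i => lshift b (s i) | inr j => rshift a (t j) end.

Lemma psum_fun_lshift s t i : psum_fun s t (lshift b i) = lshift b (s i).
Proof. by rewrite /psum_fun (unsplitK (inl i)). Qed.

Lemma psum_fun_rshift s t j : psum_fun s t (rshift a j) = rshift a (t j).
Proof. by rewrite /psum_fun (unsplitK (inr j)). Qed.

Lemma psum_fun_inj s t : injective (psum_fun s t).
Proof.
apply: (can_inj (g := psum_fun s^-1 t^-1)) => x; case: (split_ordP x) => [i ->|j ->].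
  by rewrite !psum_fun_lshift permK.
by rewrite !psum_fun_rshift permK.
Qed.

Definition psum s t : {perm 'I_(a + b)} := perm (@psum_fun_inj s t).

Lemma psum_lshift s t i : psum s t (lshift b i) = lshift b (s i).
Proof. by rewrite permE psum_fun_lshift. Qed.

Lemma psum_rshift s t j : psum s t (rshift a j) = rshift a (t j).
Proof. by rewrite permE psum_fun_rshift. Qed.

Lemma psumM s s' t t' : (psum s t * psum s' t')%g = psum (s * s')%g (t * t')%g.
Proof.
apply/permP => x; rewrite permM; case: (split_ordP x) => [i ->|j ->].
  by rewrite !psum_lshift permM.
by rewrite !psum_rshift permM.
Qed.

Lemma psum_inj s s' t t' : psum s t = psum s' t' -> s = s' /\ t = t'.
Proof.
move=> E; split; apply/permP => x.
  by apply: (@lshift_inj a b); rewrite -(psum_lshift s t) E psum_lshift.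
by apply: (@rshift_inj a b); rewrite -(psum_rshift s t) E psum_rshift.
Qed.

Lemma lrshiftF (i : 'I_a) (j : 'I_b) : (lshift b i == rshift a j) = false.
Proof. by apply/negP => /eqP/(congr1 val) /=; have := ltn_ord i; lia. Qed.

Lemma fpf_psum s t : fpf_involution (psum s t) = fpf_involution s && fpf_involution t.
Proof.
apply/fpf_involutionP/andP => [[K x]|[/fpf_involutionP[sK sx] /fpf_involutionP[tK tx]]].
  split; apply/fpf_involutionP; split=> i.
  - by have := K (lshift b i); rewrite !psum_lshift => /lshift_inj.
  - by have := x (lshift b i); rewrite psum_lshift (inj_eq (@lshift_inj _ _)).
  - by have := K (rshift a i); rewrite !psum_rshift => /rshift_inj.
  by have := x (rshift a i); rewrite psum_rshift (inj_eq (@rshift_inj _ _)).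
split=> x; case: (split_ordP x) => [i ->|j ->].
- by rewrite !psum_lshift sK.
- by rewrite !psum_rshift tK.
- by rewrite psum_lshift (inj_eq (@lshift_inj _ _)).
by rewrite psum_rshift (inj_eq (@rshift_inj _ _)).
Qed.

Lemma psum1 : psum 1 1 = 1%g.
Proof.
apply/permP => x; case: (split_ordP x) => [i ->|j ->].
  by rewrite psum_lshift !perm1.
by rewrite psum_rshift !perm1.
Qed.

Lemma ncycles_psum s t : ncycles (psum s t) = (ncycles s + ncycles t)%N.
Proof.
have X k : (psum s t ^+ k)%g = psum (s ^+ k)%g (t ^+ k)%g.
  by elim: k => [|k IH]; rewrite ?psum1 // !expgSr IH psumM.
have El i : porbit (psum s t) (lshift b i) = lshift b @: porbit s i.
  apply/setP => x; apply/porbitP/imsetP => [[k ->]|[y /porbitP[k ->] ->]].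
    by exists ((s ^+ k)%g i); rewrite ?mem_porbit // X psum_lshift.
  by exists k; rewrite X psum_lshift.
have Er i : porbit (psum s t) (rshift a i) = @rshift a b @: porbit t i.
  apply/setP => x; apply/porbitP/imsetP => [[k ->]|[y /porbitP[k ->] ->]].
    by exists ((t ^+ k)%g i); rewrite ?mem_porbit // X psum_rshift.
  by exists k; rewrite X psum_rshift.
pose fl (A : {set 'I_a}) := lshift b @: A; pose fr (A : {set 'I_b}) := @rshift a b @: A.
rewrite /ncycles (_ : porbits (psum s t) = (fl @: porbits s) :|: (fr @: porbits t)).
  rewrite cardsU (card_imset _ (imset_inj (@lshift_inj a b))) (card_imset _ (imset_inj (@rshift_inj a b))).
  rewrite (_ : _ :&: _ = set0) ?cards0 ?subn0 //; apply/setP => A; rewrite !inE.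
  apply/negP => /andP[/imsetP[_ /imsetP[i _ ->] ->] /imsetP[_ /imsetP[j _ ->] E]].
  have : lshift b i \in fr (porbit t j) by rewrite -E imset_f ?porbit_id.
  by case/imsetP => x _ /eqP; rewrite lrshiftF.
apply/setP => A; rewrite in_setU; apply/imsetP/orP => [[x _ ->]|[|]].
- case: (split_ordP x) => [i ->|j ->]; [left|right].
    by rewrite El; apply: imset_f; apply: imset_f.
  by rewrite Er; apply: imset_f; apply: imset_f.
- by case/imsetP => _ /imsetP[i _ ->] ->; exists (lshift b i); rewrite ?El.
by case/imsetP => _ /imsetP[i _ ->] ->; exists (rshift a i); rewrite ?Er.
Qed.

Lemma tau_psum : tau a (a + b) = psum (tau a a) (tau b b).
Proof.
apply/permP => x; apply: val_inj; rewrite /= tauE; case: (split_ordP x) => [i ->|j ->].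
  rewrite psum_lshift /= tauE /tauf; have := ltn_ord i.
  by do ! case: eqP; lia.
rewrite psum_rshift /= tauE /tauf; have := ltn_ord j.
by do ! case: eqP; lia.
Qed.

Lemma disconnected_psum (u : {perm 'I_(a + b)}) :
  fpf_involution u -> ~~ connected2 a u -> exists s t, u = psum s t.
Proof.
move=> /fpf_involutionP[uK _] /existsPn ncon.
have ul i : (u (lshift b i) < a)%N.
  by have := ncon (lshift b i); rewrite /= ltn_ord /= -ltnNge.
have ur j : (a <= u (rshift a j))%N.
  rewrite leqNgt; apply/negP => lt; have := ncon (u (rshift a j)).
  by rewrite lt uK /= leq_addr.
pose s i := Ordinal (ul i).
have sE i : lshift b (s i) = u (lshift b i) by apply: val_inj.
have s_inj : injective s.
  by move=> i i' E; apply/(@lshift_inj a b)/(@perm_inj _ u); rewrite -!sE E.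
have ur' j : (u (rshift a j) - a < b)%N by rewrite ltn_subLR.
pose t j := Ordinal (ur' j).
have tE j : rshift a (t j) = u (rshift a j) by apply: val_inj; rewrite /= subnKC.
have t_inj : injective t.
  by move=> i i' E; apply/(@rshift_inj a b)/(@perm_inj _ u); rewrite -!tE E.
exists (perm s_inj), (perm t_inj); apply/permP => x; case: (split_ordP x) => [i ->|j ->].
  by rewrite psum_lshift permE sE.
by rewrite psum_rshift permE tE.
Qed.

Lemma psum_disconnected s t : connected2 a (psum s t) = false.
Proof.
apply/negbTE/existsPn => x; case: (split_ordP x) => [i ->|j ->].
  by rewrite psum_lshift /= leqNgt ltn_ord.
by [].
Qed.

Lemma sum_disconnected (R : nmodType) (h : {perm 'I_(a + b)} -> R) :
  \sum_(u | fpf_involution u && ~~ connected2 a u) h u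
  = \sum_(s | fpf_involution s) \sum_(t | fpf_involution t) h (psum s t).
Proof.
rewrite pair_big_dep /=; pose f (p : {perm 'I_a} * {perm 'I_b}) := psum p.1 p.2.
have -> : \sum_(u | fpf_involution u && ~~ connected2 a u) h u
    = \sum_(u in f @: [set p | fpf_involution p.1 && fpf_involution p.2]) h u.
  apply: eq_bigl => u; apply/andP/imsetP => [[uf uc]|[[s t]]].
    have [s [t E]] := disconnected_psum uf uc; exists (s, t) => //.
    by rewrite inE /= -fpf_psum -E.
  by rewrite inE /= => stf ->; rewrite /f fpf_psum psum_disconnected.
rewrite big_imset /=; last by move=> [s t] [s' t'] _ _ /psum_inj[/= <- <-].
by apply: eq_bigl => p; rewrite inE.
Qed.
End PermSum.

(** * Formal power series *)

Definition fps : Type := nat -> rat.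
HB.instance Definition _ := gen_eqMixin fps.
HB.instance Definition _ := gen_choiceMixin fps.

Definition fps_add (f g : fps) : fps := fun n => f n + g n.
Definition fps_opp (f : fps) : fps := fun n => - f n.
Definition fps_mul (f g : fps) : fps := fun n => \sum_(i < n.+1) f i * g (n - i)%N.
Definition fps_one : fps := fun n => (n == 0%N)%:R.

(** Coefficients of a product up to degree [n] depend only on truncations, so associativity and
    commutativity are inherited from polynomials. *)
Definition fps_trunc n (f : fps) : {poly rat} := \poly_(i < n.+1) f i.

Lemma coef_fps_trunc n (f : fps) i : (i <= n)%N -> (fps_trunc n f)`_i = f i.
Proof. by move=> lein; rewrite coef_poly ltnS lein. Qed.

Lemma fps_mul_trunc n (f g : fps) i :
  (i <= n)%N -> fps_mul f g i = (fps_trunc n f * fps_trunc n g)`_i.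
Proof.
move=> lein; rewrite coefM; apply: eq_bigr => j _.
by rewrite !coef_fps_trunc //; have := ltn_ord j; lia.
Qed.

Lemma fps_trunc_mul n (f g : fps) (p : {poly rat}) i : (i <= n)%N ->
  (p * fps_trunc n (fps_mul f g))`_i = (p * (fps_trunc n f * fps_trunc n g))`_i.
Proof.
move=> lein; rewrite !coefM; apply: eq_bigr => j _; have := ltn_ord j => lj.
by rewrite coef_fps_trunc -?fps_mul_trunc //; lia.
Qed.

Lemma fps_addA : associative fps_add.
Proof. by move=> f g h; apply/funext => n; apply: addrA. Qed.
Lemma fps_addC : commutative fps_add.
Proof. by move=> f g; apply/funext => n; apply: addrC. Qed.
Lemma fps_add0 : left_id (fun=> 0 : rat) fps_add.
Proof. by move=> f; apply/funext => n; apply: add0r. Qed.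
Lemma fps_addN : left_inverse (fun=> 0 : rat) fps_opp fps_add.
Proof. by move=> f; apply/funext => n; apply: addNr. Qed.
Lemma fps_mulC : commutative fps_mul.
Proof.
by move=> f g; apply/funext => n; rewrite !(@fps_mul_trunc n) // mulrC.
Qed.
Lemma fps_mulA : associative fps_mul.
Proof.
move=> f g h; apply/funext => n; rewrite [fps_mul (fps_mul f g) h]fps_mulC !(@fps_mul_trunc n) //.
by rewrite !fps_trunc_mul // mulrA mulrC.
Qed.
Lemma fps_mul1 : left_id fps_one fps_mul.
Proof.
move=> f; apply/funext => n; rewrite /fps_mul big_ord_recl subn0 mul1r big1 ?addr0 //.
by move=> i _; rewrite /fps_one lift0 mul0r.
Qed.
Lemma fps_mulD : left_distributive fps_mul fps_add.
Proof.
move=> f g h; apply/funext => n; rewrite /fps_add -big_split /=.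
by apply: eq_bigr => i _; rewrite mulrDl.
Qed.
Lemma fps_one_neq0 : fps_one != (fun=> 0).
Proof. by apply/eqP => /(congr1 (fun f => f 0%N)) /eqP. Qed.

HB.instance Definition _ := GRing.isZmodule.Build fps fps_addA fps_addC fps_add0 fps_addN.
HB.instance Definition _ :=
  GRing.Zmodule_isComNzRing.Build fps fps_mulA fps_mulC fps_mul1 fps_mulD fps_one_neq0.

Lemma fpsD (f g : fps) n : (f + g) n = f n + g n. Proof. by []. Qed.
Lemma fpsB (f g : fps) n : (f - g) n = f n - g n. Proof. by []. Qed.
Lemma fpsM (f g : fps) n : (f * g) n = \sum_(i < n.+1) f i * g (n - i)%N.
Proof. by []. Qed.
Lemma fps1 n : (1 : fps) n = (n == 0%N)%:R. Proof. by []. Qed.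
Lemma fps_sum (I : Type) (r : seq I) (P : pred I) (F : I -> fps) n :
  (\sum_(i <- r | P i) F i) n = \sum_(i <- r | P i) F i n.
Proof. by elim/big_rec2: _ => // i x y _ <-. Qed.
Lemma fpsMn (f : fps) k n : (f *+ k) n = f n *+ k.
Proof. by elim: k => [|k IH]; rewrite ?mulr0n // !mulrS fpsD IH. Qed.
Lemma fps_natM (f : fps) k n : (k%:R * f) n = k%:R * f n.
Proof. by rewrite !mulr_natl fpsMn. Qed.

Definition fpsX : fps := fun n => (n == 1%N)%:R.

Lemma fpsXM (f : fps) n : (fpsX * f) n = if n is m.+1 then f m else 0.
Proof.
rewrite fpsM; case: n => [|n]; first by rewrite big_ord1 mul0r.
rewrite big_ord_recl mul0r add0r big_ord_recl mul1r big1 ?addr0 => [|i _].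
  by rewrite lift0 subSS subn0.
by rewrite /fpsX !lift0 mul0r.
Qed.

Lemma fpsXnM (f : fps) k n : (fpsX ^+ k * f) n = if (k <= n)%N then f (n - k)%N else 0.
Proof.
elim: k n => [|k IH] n; first by rewrite expr0 mul1r subn0.
by rewrite exprS -mulrA fpsXM; case: n => // n; rewrite IH ltnS subSS.
Qed.

Definition fps_poly (p : {poly rat}) : fps := fun n => p`_n.

Lemma fps_poly_is_zmod_morphism : zmod_morphism fps_poly.
Proof. by move=> p q; apply/funext => n; rewrite /fps_poly coefB. Qed.
Lemma fps_poly_is_monoid_morphism : monoid_morphism fps_poly.
Proof.
split=> [|p q]; apply/funext => n; first by rewrite /fps_poly coef1.
by rewrite /fps_poly coefM.
Qed.
HB.instance Definition _ :=
  GRing.isZmodMorphism.Build _ _ fps_poly fps_poly_is_zmod_morphism.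
HB.instance Definition _ :=
  GRing.isMonoidMorphism.Build _ _ fps_poly fps_poly_is_monoid_morphism.

Lemma fps_polyX : fps_poly 'X = fpsX.
Proof. by apply/funext => n; rewrite /fps_poly coefX. Qed.

Lemma fps_polyC c (f : fps) n : (fps_poly c%:P * f) n = c * f n.
Proof.
rewrite fpsM big_ord_recl subn0 big1 ?addr0 => [|i _]; first by rewrite /fps_poly coefC eqxx.
by rewrite /fps_poly coefC lift0 mul0r.
Qed.

(** Lets identities of rational functions be proved after multiplication by the denominators,
    without inverses of series. *)
Lemma fps_mulI (f : fps) : f 0%N != 0 -> injective ( *%R f).
Proof.
move=> f0 g h E; apply/funext => n; elim/ltn_ind: n => n IH.
have := congr1 (fun u => u n) E; rewrite /= !fpsM !big_ord_recl !subn0.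
rewrite [in X in X = _](eq_bigr (fun i : 'I_n => f (lift ord0 i) * h (n - lift ord0 i)%N)).
  by move/addIr/(mulfI f0).
by move=> i _; rewrite IH // lift0; have := ltn_ord i; lia.
Qed.

(** The Euler operator [x d/dx]. *)
Definition fps_theta (f : fps) : fps := fun n => n%:R * f n.

Lemma fps_thetaD f g : fps_theta (f + g) = fps_theta f + fps_theta g.
Proof. by apply/funext => n; rewrite /fps_theta !fpsD mulrDr. Qed.

Lemma fps_thetaB f g : fps_theta (f - g) = fps_theta f - fps_theta g.
Proof. by apply/funext => n; rewrite /fps_theta !fpsB mulrBr. Qed.

Lemma fps_theta1 : fps_theta 1 = 0.
Proof. by apply/funext => -[|n]; rewrite /fps_theta ?mul0r // fps1 mulr0. Qed.

Lemma fps_thetaX : fps_theta fpsX = fpsX.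
Proof. by apply/funext => -[|[|n]]; rewrite /fps_theta /fpsX ?mul0r ?mulr1 ?mulr0. Qed.

Lemma fps_thetaM f g : fps_theta (f * g) = fps_theta f * g + f * fps_theta g.
Proof.
apply/funext => n; rewrite fpsD /fps_theta !fpsM mulr_sumr -big_split /=.
apply: eq_bigr => i _; have -> : n%:R = i%:R + (n - i)%:R :> rat.
  by rewrite -natrD; congr _%:R; have := ltn_ord i; lia.
by rewrite mulrDl !mulrA; rewrite [f i * _%:R]mulrC.
Qed.

Lemma fps_thetaX_exp f k : fps_theta (f ^+ k.+1) = k.+1%:R * f ^+ k * fps_theta f.
Proof.
elim: k => [|k IH]; first by rewrite !expr1 expr0 !mul1r.
by rewrite exprS fps_thetaM {}IH (exprS f k) -[k.+2%:R]natr1; ring.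
Qed.

(** * The Harer-Zagier recursion *)

(** The expansion of [1 / (1 - x)^(k+1)]. *)
Definition fps_geom (k : nat) : fps := fun n => 'C(n + k, k)%:R.

Lemma fps_geom0 : (1 - fpsX) * fps_geom 0 = 1.
Proof.
apply/funext => n; rewrite mulrBl mul1r fpsB fpsXM fps1 /fps_geom.
by case: n => [|n]; rewrite !bin0 ?subr0 ?subrr.
Qed.

Lemma fps_geomS k : (1 - fpsX) * fps_geom k.+1 = fps_geom k.
Proof.
apply/funext => n; rewrite mulrBl mul1r fpsB fpsXM /fps_geom.
case: n => [|n]; first by rewrite subr0 !add0n !binn.
by rewrite addSn binS natrD -addSnnS addrC addKr addSnnS.
Qed.

Lemma fps_geom_exp k : (1 - fpsX) ^+ k.+1 * fps_geom k = 1.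
Proof.
elim: k => [|k IH]; first by rewrite expr1 fps_geom0.
by rewrite exprSr -mulrA fps_geomS.
Qed.

Lemma fpsXn_geom k l n : (l <= k)%N ->
  (fpsX ^+ l * fps_geom k) n = 'C(n + k - l, k)%:R.
Proof.
move=> lk; rewrite fpsXnM /fps_geom; case: leqP => ln; first by rewrite addnBAC.
by rewrite bin_small //; lia.
Qed.

Lemma fps_1X_inj : injective ( *%R (1 - fpsX)).
Proof. by apply: fps_mulI; rewrite fpsB fps1 /fpsX subr0. Qed.
Lemma fps_1Xexp_inj k : injective ( *%R ((1 - fpsX) ^+ k)).
Proof.
elim: k => [|k IH] f g; first by rewrite !expr0 !mul1r.
by rewrite /= !exprS -!mulrA => /fps_1X_inj/IH.
Qed.
Lemma fps_1pX_inj : injective ( *%R (1 + fpsX)).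
Proof. by apply: fps_mulI; rewrite fpsD fps1 /fpsX addr0. Qed.

(** A series indexed by the evaluation point [N]: what the long cycle sum becomes at [q = 1/N],
    normalised to the average of [N] to the number of cycles over the pairings with [n.+1]
    chords. *)
Definition alt_sum (n : nat) : fps := fun N =>
  \sum_(j < n.+1) (-1) ^+ j * 'C(n, j)%:R *
    (N%:R * 'C(N + (2 * n).+1 - 2 * j, (2 * n).+1)%:R
     - (2 * (n - j) + 1)%:R * 'C(N + (2 * n).+1 - (2 * j).+1, (2 * n).+1)%:R).

(** With [Y = (1 - x^2)^n] and [H = 1 / (1 - x)^(2n+2)], the alternating sum of binomials is a
    coefficient of [Y * H]. The factor [N] is the Euler operator on that product, and
    [2 * (n - j) + 1 = K - 2 * j] is [K] minus the Euler operator on [Y]. The differential equations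
    of [Y] and [H] then leave a multiple of [Y * H = (1 + x)^n / (1 - x)^(n+2)]. *)
Lemma alt_sumE n : (1 - fpsX) ^+ n.+3 * alt_sum n = fpsX * (1 + fpsX) ^+ n.+1.
Proof.
pose K := (2 * n).+1; pose H := fps_geom K; pose Y := (1 - fpsX ^+ 2) ^+ n.
have YE : Y = \sum_(j < n.+1) fps_poly ((-1) ^+ j * 'C(n, j)%:R)%:P * fpsX ^+ (2 * j).
  rewrite /Y exprBn; apply: eq_bigr => j _.
  rewrite expr1n mulr1 -exprM -[fps_poly _%:P]/((fps_poly \o polyC) _).
  by rewrite rmorphM rmorph_sign rmorph_nat -[LHS]mulr_natr mulrAC.
have tY : fps_theta Y = \sum_(j < n.+1) fps_poly ((-1) ^+ j * 'C(n, j)%:R)%:P *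
    ((2 * j)%:R * fpsX ^+ (2 * j)).
  apply/funext => N; rewrite /fps_theta YE !fps_sum mulr_sumr; apply: eq_bigr => j _.
  rewrite !fps_polyC fps_natM mulrCA; congr (_ * _).
  have E k : (fpsX ^+ k) N = (N == k)%:R.
    rewrite -[_ ^+ k]mulr1 fpsXnM fps1; case: leqP => kN; first by rewrite subn_eq0 eqn_leq kN andbT.
    by rewrite ltn_eqF.
  by rewrite E; case: eqP => [->//|_]; rewrite !mulr0.
have E : alt_sum n = fps_theta (Y * H) - fpsX * ((K%:R * Y - fps_theta Y) * H).
  have -> : K%:R * Y - fps_theta Y = \sum_(j < n.+1)
      fps_poly ((-1) ^+ j * 'C(n, j)%:R)%:P * ((2 * (n - j) + 1)%:R * fpsX ^+ (2 * j)).
    rewrite tY YE mulr_sumr -sumrB; apply: eq_bigr => j _.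
    rewrite mulrCA -mulrBr -mulrBl -natrB; last by rewrite /K; have := ltn_ord j; lia.
    by congr (_ * (_%:R * _)); rewrite /K; have := ltn_ord j; lia.
  rewrite YE !mulr_suml mulr_sumr; apply/funext => N.
  rewrite fpsB /fps_theta !fps_sum mulr_sumr -sumrB; apply: eq_bigr => j _.
  have lj := ltn_ord j.
  rewrite mulrBr -!mulrA !fps_polyC fpsXn_geom; last by rewrite /K; lia.
  rewrite (mulrCA fpsX) fps_polyC (mulrCA fpsX) fps_natM [fpsX * _]mulrA -exprS fpsXn_geom; last by rewrite /K; lia.
  by rewrite [N%:R * (_ * _ * _)]mulrCA !mulrA.
have tH : (1 - fpsX) * fps_theta H = K.+1%:R * fpsX * H.
  apply: (@fps_1Xexp_inj K).
  have := congr1 fps_theta (fps_geom_exp K); rewrite fps_thetaM fps_thetaX_exp fps_theta1.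
  rewrite fps_thetaB fps_theta1 fps_thetaX sub0r -/H => /eqP.
  rewrite addr_eq0 => /eqP E0; rewrite mulrA -exprSr -[LHS]opprK -E0.
  by move: (K.+1%:R) ((1 - fpsX) ^+ K) (fps_theta H) => a b d; ring.
have tY2 : (1 - fpsX ^+ 2) * fps_theta Y = - (2 * n)%:R * fpsX ^+ 2 * Y.
  rewrite /Y; case: n {YE tY E tH K H Y} => [|n].
    by rewrite expr0 fps_theta1 muln0 oppr0 !mul0r mulr0.
  rewrite fps_thetaX_exp fps_thetaB fps_theta1 fps_thetaX_exp fps_thetaX (exprS _ n) natrM.
  by move: (n.+1%:R) ((_ - _) ^+ n) => a b; ring.
have E2 : (1 - fpsX) * alt_sum n = fpsX * (1 + fpsX) * (Y * H).
  apply: fps_1pX_inj; apply: fps_1X_inj; rewrite E fps_thetaM.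
  transitivity ((1 - fpsX) * ((1 - fpsX ^+ 2) * fps_theta Y) * H
    + (1 - fpsX ^+ 2) * Y * ((1 - fpsX) * fps_theta H)
    - (1 - fpsX) * fpsX * (1 - fpsX ^+ 2) * K%:R * Y * H
    + (1 - fpsX) * fpsX * ((1 - fpsX ^+ 2) * fps_theta Y) * H).
    by move: (fps_theta Y) (fps_theta H) (K%:R) => a b c; ring.
  rewrite tH tY2 /K -[(2 * n).+2%:R]natr1 -[(2 * n).+1%:R]natr1.
  by move: ((2 * n)%:R) => a; ring.
rewrite exprSr -mulrA E2.
transitivity ((1 - fpsX) ^+ (2 * n).+2 * H * fpsX * (1 + fpsX) ^+ n.+1).
  have -> : (2 * n).+2 = (n + n.+2)%N by lia.
  rewrite exprD /Y (_ : 1 - fpsX ^+ 2 = (1 - fpsX) * (1 + fpsX)); last by ring.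
  rewrite exprMn (exprS (1 + fpsX)); ring.
by rewrite fps_geom_exp mul1r.
Qed.

(** Consecutive [u] differ by the factor [(1 + x) / (1 - x)] and the logarithmic derivative of each
    is rational, so everything is a rational multiple of [u n.+1]. As [fps_theta] multiplies the
    coefficient of index [N] by [N], this is a recursion between polynomials in [N]. *)
Lemma three_term (u : nat -> fps) :
  (forall n, (1 - fpsX) ^+ n.+2 * u n = fpsX * (1 + fpsX) ^+ n) ->
  forall n, n.+3%:R * u n.+2 = 2%:R * fps_theta (u n.+1) + n.+1%:R * u n.
Proof.
move=> uE n.
have step k : (1 - fpsX) * u k.+1 = (1 + fpsX) * u k.
  apply: (@fps_1Xexp_inj k.+2).
  by rewrite mulrA -exprSr uE mulrCA uE exprS mulrCA mulrA.
have th k : (1 - fpsX) * ((1 + fpsX) * fps_theta (u k))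
    = (1 + (2 * k.+1)%:R * fpsX + fpsX ^+ 2) * u k.
  apply: (@fps_1Xexp_inj k.+1).
  have : fps_theta ((1 - fpsX) ^+ k.+2 * u k) * (1 + fpsX)
      = fps_theta (fpsX * (1 + fpsX) ^+ k) * (1 + fpsX) by rewrite uE.
  rewrite (fps_thetaM ((1 - fpsX) ^+ k.+2)) (fps_thetaM fpsX) fps_thetaX_exp.
  rewrite fps_thetaB fps_theta1 fps_thetaX sub0r mulrDl.
  have -> : (fpsX * (1 + fpsX) ^+ k + fpsX * fps_theta ((1 + fpsX) ^+ k)) * (1 + fpsX)
      = (1 + fpsX + k%:R * fpsX) * (fpsX * (1 + fpsX) ^+ k).
    case: k => [|k]; first by rewrite expr0 fps_theta1; ring.
    rewrite fps_thetaX_exp fps_thetaD fps_theta1 fps_thetaX (exprS _ k).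
    by move: (k.+1%:R) ((1 + fpsX) ^+ k) => a b; ring.
  rewrite -uE => /(canRL (addKr _)) E.
  rewrite mulrA -exprSr [(1 + fpsX) * _]mulrC mulrA E.
  rewrite natrM -[k.+2%:R]natr1 -[k.+1%:R]natr1 (exprS _ k.+1).
  by move: (k%:R) ((1 - fpsX) ^+ k.+1) (u k) => a b c; ring.
apply: fps_1X_inj; apply: fps_1pX_inj.
transitivity (n.+3%:R * ((1 + fpsX) * ((1 - fpsX) * u n.+2))); first by ring.
rewrite step.
transitivity (2%:R * ((1 - fpsX) * ((1 + fpsX) * fps_theta (u n.+1)))
   + n.+1%:R * ((1 - fpsX) * ((1 + fpsX) * u n))); last by ring.
rewrite th -(step n) natrM -[n.+3%:R]natr1 -[n.+2%:R]natr1 -[n.+1%:R]natr1.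
by move: (n%:R) (u n.+1) => a b; ring.
Qed.

(** * Diagrams counted by their number of faces *)

Definition fpf_count (m : nat) : nat := #|[set s : {perm 'I_m} | fpf_involution s]|.

Lemma fpf_count0 : fpf_count 0 = 1%N.
Proof.
rewrite /fpf_count (_ : [set s | _] = [set 1%g]) ?cards1 //.
apply/setP => s; rewrite !inE; have -> : s = 1%g by apply/permP => -[].
by rewrite eqxx; apply/fpf_involutionP; split => -[].
Qed.

Lemma fpf_countSS m : fpf_count m.+2 = (m.+1 * fpf_count m)%N.
Proof.
have E k : fpf_count k = (\sum_(s : {perm 'I_k} | fpf_involution s) 1)%N.
  by rewrite sum1dep_card.
rewrite !E (@sum_ins_chord nat m (fun=> 1%N)) sum_nat_const card_ord.
by rewrite !sum1dep_card.
Qed.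

Lemma fpf_count_gt0 n : (0 < fpf_count (2 * n))%N.
Proof.
elim: n => [|n IH]; first by rewrite muln0 fpf_count0.
by have -> : (2 * n.+1 = (2 * n).+2)%N; [lia|rewrite fpf_countSS muln_gt0].
Qed.

Lemma fpf_countE n : (fpf_count (2 * n) * (2 ^ n * n`!))%N = (2 * n)`!.
Proof.
elim: n => [|n IH]; first by rewrite muln0 fpf_count0.
have -> : (2 * n.+1 = (2 * n).+2)%N by lia.
by rewrite fpf_countSS !factS -IH expnS; lia.
Qed.

Lemma ncycles_gt0 m (s : {perm 'I_m.+1}) : (0 < ncycles s)%N.
Proof. by apply/card_gt0P; exists (porbit s ord0); apply: imset_f. Qed.

(* The convention that an empty backbone has one boundary component. *)
Definition nfaces m (s : {perm 'I_m}) : nat := ((m == 0) + ncycles (s * tau m m)%g)%N.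

Definition face_poly m : {poly rat} := \sum_(s : {perm 'I_m} | fpf_involution s) 'X^(nfaces s).

Lemma face_poly0 : face_poly 0 = 'X.
Proof.
rewrite /face_poly (big_pred1 1%g) => [|s].
  rewrite /nfaces /ncycles -[RHS]expr1; congr (_ ^+ _).
  by rewrite (_ : porbits _ = set0) ?cards0 //; apply/setP => A; rewrite inE; apply/imsetP => -[[]].
rewrite /= (_ : s = 1%g) ?eqxx; last by apply/permP => -[].
by apply/fpf_involutionP; split => -[].
Qed.

Lemma coef_face_poly m r : (face_poly m)`_r
  = #|[set s : {perm 'I_m} | fpf_involution s && (nfaces s == r)]|%:R.
Proof.
rewrite /face_poly coef_sum -sum1dep_card natr_sum [RHS]big_mkcondr /=.
by apply: eq_bigr => s _; rewrite coefXn eq_sym; case: eqP.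
Qed.

Lemma prod_falling (N k : nat) : \prod_(i < k) (N%:R - i%:R) = (N ^_ k)%:R :> rat.
Proof.
elim: k => [|k IH]; first by rewrite big_ord0.
rewrite big_ord_recr /= IH ffactnSr natrM; case: (leqP k N) => kN; first by rewrite natrB.
by rewrite ffact_small // !mul0r.
Qed.

Lemma prod_rising (N k : nat) : \prod_(i < k) (N%:R + i%:R) = ((N + k).-1 ^_ k)%:R :> rat.
Proof.
elim: k => [|k IH]; first by rewrite big_ord0.
by rewrite big_ord_recr /= IH addnS /= ffactnS natrM natrD mulrC.
Qed.

(** The run going down from [N] and the run going up from [N] join into consecutive integers once
    one factor [N] is split off. *)
Lemma ffact_mul_rising N k l :
  (N ^_ k * (N + l.+1).-1 ^_ l.+1 = N * (N + l) ^_ (l + k))%N.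
Proof.
rewrite addnS /=; elim: k => [|k IH].
  by rewrite ffactn0 mul1n addn0 ffactnSr addnK mulnC.
rewrite ffactnSr mulnAC IH addnS ffactnSr -mulnA.
by congr (_ * (_ * _))%N; lia.
Qed.

Lemma stirling_prodE (N K k : nat) : (0 < N)%N -> (k <= K)%N ->
  N%:R ^+ K.+1 * stirling_prod (N%:R^-1) K.+1 k
  = N%:R * (K`!)%:R * 'C(N + K - k, K)%:R :> rat.
Proof.
move=> N0 kK; have N0' : N%:R != 0 :> rat by rewrite pnatr_eq0 -lt0n.
have pow l : N%:R ^+ l = \prod_(i < l) N%:R :> rat by rewrite prodr_const card_ord.
transitivity (\prod_(i < k) (N%:R - i%:R) * \prod_(i < K.+1 - k) (N%:R + i%:R) : rat).
  rewrite /stirling_prod -[in N%:R ^+ _](subnKC (leqW kK)) exprD mulrACA; congr (_ * _).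
    rewrite pow -big_split; apply: eq_bigr => i _ /=.
    by rewrite mulrBr mulr1 mulrCA mulfV // mulr1.
  rewrite pow -big_split; apply: eq_bigr => i _ /=.
  by rewrite mulrDr mulr1 mulrCA mulfV // mulr1.
rewrite prod_falling prod_rising -[LHS]natrM subSn // ffact_mul_rising -!natrM.
congr _%:R; rewrite subnK // -mulnA [(K`! * _)%N]mulnC bin_ffact.
by congr (_ * (_ ^_ _))%N; lia.
Qed.

Lemma face_poly_eval n (N : nat) :
  (face_poly (2 * n.+1)).[N%:R] = (fpf_count (2 * n.+1))%:R * alt_sum n N.
Proof.
have mE : (2 * n.+1 = (2 * n).+2)%N by lia.
have nf (s : {perm 'I_(2 * n.+1)}) : nfaces s = ncycles (s * tau (2 * n.+1) (2 * n.+1))%g.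
  by rewrite /nfaces (_ : (2 * n.+1 == 0)%N = false) // mE.
(* There is no [q = 1/N] at [N = 0]; there both sides are 0, as a permutation of a nonempty set has
   a cycle. *)
rewrite /face_poly horner_sum; case: (posnP N) => [->|N0].
  rewrite /alt_sum !big1 ?mulr0 // => [j _|s _].
    by rewrite mul0r sub0r (@bin_small (0 + _ - _)) ?mulr0 ?oppr0 ?mulr0 //; have := ltn_ord j; lia.
  rewrite hornerXn nf; move: s; rewrite mE => s.
  by have := ncycles_gt0 (s * tau (2 * n).+2 (2 * n).+2); case: (ncycles _) => // r; rewrite expr0n.
have N0' : N%:R != 0 :> rat by rewrite pnatr_eq0 -lt0n.
have f0 : ((2 * n).+1`!)%:R != 0 :> rat by rewrite pnatr_eq0 -lt0n fact_gt0.
apply: (mulfI f0).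
transitivity (N%:R ^+ (2 * n.+1) * (((2 * n).+1`!)%:R *
    \sum_(s : {perm 'I_(2 * n.+1)} | fpf_involution s)
      N%:R^-1 ^+ plen (s * tau (2 * n.+1) (2 * n.+1))%g) : rat).
  rewrite mulrCA; congr (_ * _); rewrite mulr_sumr; apply: eq_bigr => s _.
  rewrite hornerXn nf /plen card_ord; set r := #|_|.
  have rm : (r <= 2 * n.+1)%N by rewrite -[X in (_ <= X)%N]card_ord; apply: card_porbits_le.
  rewrite exprVn; apply: (canRL (mulfK (expf_neq0 _ N0'))).
  by rewrite -exprD subnKC.
rewrite sum_fpf_plen mulrCA [RHS]mulrCA; congr (_ * _).
rewrite /alt_sum !mulr_sumr; apply: eq_bigr => j _; have lj := ltn_ord j.
rewrite mulrCA [RHS]mulrCA; congr (_ * _).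
have lK : (2 * j <= (2 * n).+1)%N by lia.
have lK' : ((2 * j).+1 <= (2 * n).+1)%N by lia.
have := stirling_prodE N0 lK; have := stirling_prodE N0 lK'.
rewrite -mE mulrBr => E1 E2; rewrite E2 [N%:R ^+ _ * (_ * _ * _)]mulrCA E1.
by field.
Qed.

Lemma poly_eq_on_nat (p q : {poly rat}) :
  (forall N : nat, p.[N%:R] = q.[N%:R]) -> p = q.
Proof.
move=> pq; apply/eqP; rewrite -subr_eq0; apply/negPn/negP => d0.
pose s : seq rat := [seq N%:R | N <- iota 0 (size (p - q))].
have us : uniq s by rewrite map_inj_uniq ?iota_uniq // => a b /eqP; rewrite eqr_nat => /eqP.
have rs : all (root (p - q)) s.
  by apply/allP => _ /mapP[N _ ->]; rewrite /root hornerD hornerN pq subrr.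
by have := max_poly_roots d0 rs us; rewrite size_map size_iota ltnn.
Qed.

Definition avg_face_poly (n : nat) : {poly rat} :=
  (fpf_count (2 * n))%:R^-1 *: face_poly (2 * n).

Lemma fpf_count_neq0 n : (fpf_count (2 * n))%:R != 0 :> rat.
Proof. by rewrite pnatr_eq0 -lt0n fpf_count_gt0. Qed.

Lemma avg_face_poly0 : avg_face_poly 0 = 'X.
Proof. by rewrite /avg_face_poly muln0 fpf_count0 face_poly0 invr1 scale1r. Qed.

Lemma avg_face_polyS_eval n (N : nat) : (avg_face_poly n.+1).[N%:R] = alt_sum n N.
Proof. by rewrite hornerZ face_poly_eval mulKf // fpf_count_neq0. Qed.

Lemma avg_face_poly1 : avg_face_poly 1 = 'X^2.
Proof.
apply: poly_eq_on_nat => N; rewrite avg_face_polyS_eval hornerXn.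
have -> : alt_sum 0 N = N%:R * 'C(N + 1 - 0, 1)%:R - 1%:R * 'C(N + 1 - 1, 1)%:R.
  by rewrite /alt_sum big_ord1 expr0 bin0 !mul1r.
by rewrite !bin1 subn0 addnK natrD; ring.
Qed.

(** Division by [(2n-1)!!] absorbs the odd factors of the classical form [(n+1) c_g(n) = 2(2n-1)
    c_g(n-1) + (2n-1)(n-1)(2n-3) c_(g-1)(n-2)]. *)
Lemma harer_zagier n :
  n.+3%:R *: avg_face_poly n.+2
  = 2%:R *: ('X * avg_face_poly n.+1) + n.+1%:R *: avg_face_poly n.
Proof.
pose u k : fps := fun N => (avg_face_poly k).[N%:R].
have uE k : (1 - fpsX) ^+ k.+2 * u k = fpsX * (1 + fpsX) ^+ k.
  case: k => [|k].
    have -> : u 0%N = fpsX * fps_geom 1.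
      apply/funext => N; rewrite /u avg_face_poly0 hornerX fpsXM /fps_geom.
      by case: N => // N; rewrite bin1 addn1.
    by rewrite mulrCA fps_geom_exp expr0.
  have -> : u k.+1 = alt_sum k by apply/funext => N; apply: avg_face_polyS_eval.
  exact: alt_sumE.
have T := three_term uE n.
apply: poly_eq_on_nat => N; have := congr1 (fun f => f N) T.
rewrite /= fpsD !fps_natM => E.
by rewrite hornerD (hornerZ n.+3%:R) (hornerZ 2%:R) (hornerZ n.+1%:R) hornerM hornerX.
Qed.

Lemma coef_harer_zagier n r :
  n.+3%:R * (avg_face_poly n.+2)`_r
  = 2%:R * (if r is r'.+1 then (avg_face_poly n.+1)`_r' else 0)
    + n.+1%:R * (avg_face_poly n)`_r.
Proof.
have := congr1 (fun p : {poly rat} => p`_r) (harer_zagier n).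
by rewrite /= coefD !coefZ coefXM; case: r.
Qed.

(** Of the two terms of the recursion, one keeps [n + 1 - r] and the other raises it by 2. *)
Lemma avg_face_poly_euler n r :
  (avg_face_poly n)`_r != 0 -> exists g, n.+1 = (2 * g + r)%N.
Proof.
suff H : (forall r, (avg_face_poly n)`_r != 0 -> exists g, n.+1 = (2 * g + r)%N) /\
         (forall r, (avg_face_poly n.+1)`_r != 0 -> exists g, n.+2 = (2 * g + r)%N).
  by case: H => H _; apply: H.
elim: n {r} => [|n [IH0 IH1]]; split=> // r.
- rewrite avg_face_poly0 coefX; have [->|] := eqVneq r 1%N; last by rewrite eqxx.
  by exists 0%N.
- rewrite avg_face_poly1 coefXn; have [->|] := eqVneq r 2%N; last by rewrite eqxx.
  by exists 0%N.
move=> hr; have : n.+3%:R * (avg_face_poly n.+2)`_r != 0 by rewrite mulf_neq0 ?pnatr_eq0.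
rewrite coef_harer_zagier => nz.
have [z0|/IH0[g E]] := eqVneq (avg_face_poly n)`_r 0; last by exists g.+1; lia.
case: r {hr} nz z0 => [|r] nz z0; first by rewrite z0 !mulr0 addr0 eqxx in nz.
have [z1|/IH1[g E]] := eqVneq (avg_face_poly n.+1)`_r 0; last by exists g; lia.
by rewrite z0 z1 !mulr0 addr0 eqxx in nz.
Qed.

(** The coefficients count diagrams, so a single diagram makes its coefficient nonzero. This gives
    every diagram a genus in the natural numbers. *)
Lemma nfaces_euler n (s : {perm 'I_(2 * n)}) :
  fpf_involution s -> exists g, n.+1 = (2 * g + nfaces s)%N.
Proof.
move=> sf; apply: avg_face_poly_euler; rewrite coefZ coef_face_poly.
rewrite mulf_neq0 ?invr_neq0 ?fpf_count_neq0 // pnatr_eq0 -lt0n.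
by apply/card_gt0P; exists s; rewrite inE sf eqxx.
Qed.

Lemma c1E g n :
  c1 g n = #|[set s : {perm 'I_(2 * n)} | fpf_involution s && (n.+1 == 2 * g + nfaces s)%N]|.
Proof.
case: n => [|n] //.
have -> : [set s : {perm 'I_(2 * 0)} | fpf_involution s && (1 == 2 * g + nfaces s)%N]
    = if g == 0%N then [set 1%g] else set0.
  apply/setP => s; have -> : s = 1%g by apply/permP => -[].
  rewrite inE (_ : fpf_involution _ = true) ?andTb; last by apply/fpf_involutionP; split => -[].
  have -> : nfaces (1%g : {perm 'I_(2 * 0)}) = 1%N.
    rewrite /nfaces /ncycles (_ : porbits _ = set0) ?cards0 //.
    by apply/setP => A; rewrite inE; apply/imsetP => -[[]].
  by case: g => [|g] /=; rewrite !inE ?eqxx //; apply/eqP; lia.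
by rewrite /c1; case: (g == 0%N); rewrite ?cards1 ?cards0.
Qed.

Definition c1_avg (g n : nat) : rat := (c1 g n)%:R / (fpf_count (2 * n))%:R.

Lemma c1_avgE g n : c1_avg g n =
  if (2 * g <= n.+1)%N then (avg_face_poly n)`_(n.+1 - 2 * g) else 0.
Proof.
rewrite /c1_avg c1E coefZ coef_face_poly mulrC; case: leqP => h.
  congr (_ * _%:R); apply: eq_card => s; rewrite !inE; congr (_ && _).
  by apply/eqP/eqP; lia.
rewrite (_ : [set s | _] = set0) ?cards0 ?mulr0 //.
apply/setP => s; rewrite !inE; apply/negbTE/negP => /andP[_ /eqP]; lia.
Qed.

Lemma c1_avg_genusS g n :
  n.+3%:R * c1_avg g.+1 n.+2 = 2%:R * c1_avg g.+1 n.+1 + n.+1%:R * c1_avg g n.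
Proof.
rewrite !c1_avgE; have -> : (2 * g.+1 <= n.+3)%N = (2 * g <= n.+1)%N by lia.
case: (leqP (2 * g) n.+1) => h; last by rewrite (_ : (2 * g.+1 <= n.+2)%N = false) ?mulr0 ?addr0 //; lia.
have -> : (n.+3 - 2 * g.+1 = n.+1 - 2 * g)%N by lia.
rewrite coef_harer_zagier; case: (posnP (n.+1 - 2 * g)) => [E|lt0].
  by rewrite E (_ : (_ <= _)%N = false) //; lia.
have -> : (n.+1 - 2 * g = (n.+2 - 2 * g.+1).+1)%N by lia.
by rewrite (_ : (_ <= _)%N = true) //; lia.
Qed.

Lemma c1_avg_genus0 n : n.+2%:R * c1_avg 0 n.+1 = 2%:R * c1_avg 0 n.
Proof.
case: n => [|n]; rewrite !c1_avgE muln0 !subn0.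
  by rewrite avg_face_poly0 avg_face_poly1 coefX coefXn.
have z : (avg_face_poly n)`_n.+3 = 0.
  by apply: contraTeq isT => /avg_face_poly_euler[g E]; lia.
by rewrite coef_harer_zagier z mulr0 addr0.
Qed.

Lemma c1_avg_init g : [/\ c1_avg 0 0 = 1, c1_avg g.+1 0 = 0 & c1_avg g.+1 1 = 0].
Proof.
rewrite !c1_avgE avg_face_poly0 avg_face_poly1 !coefX !coefXn muln0 subn0; split=> //.
  by case: leqP => //; lia.
by case: leqP => h //; rewrite (_ : (2 - 2 * g.+1 == 2)%N = false) //; lia.
Qed.

(** * Cutting a backbone *)

Lemma fpf_odd_false m (s : {perm 'I_m}) : odd m -> fpf_involution s = false.
Proof.
move=> om; apply/negP => /fpf_involutionP[sK sx].
by move: om; have := card_involution sK sx; rewrite card_ord => ->; rewrite mul2n odd_double.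
Qed.

Definition genus_count m (N G : nat) : nat :=
  (\sum_(s : {perm 'I_m} | fpf_involution s) (N == G + nfaces s))%N.

Lemma c1_genus_count g n : c1 g n = genus_count (2 * n) n.+1 (2 * g).
Proof.
rewrite c1E /genus_count -sum1dep_card big_mkcondr.
by apply: eq_bigr => s _; case: eqP.
Qed.

Lemma sum_disconnected_faces (m a b N G : nat) : m = (a + b)%N ->
  (\sum_(s : {perm 'I_m} | fpf_involution s && ~~ connected2 a s)
     (N == G + (ncycles (s * tau a m)%g + (a == 0) + (b == 0))))%N
  = (\sum_(s : {perm 'I_a} | fpf_involution s) \sum_(t : {perm 'I_b} | fpf_involution t)
      (N == G + (nfaces s + nfaces t)))%N.
Proof.
move=> ->; rewrite sum_disconnected; apply: eq_bigr => s _; apply: eq_bigr => t _.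
rewrite tau_psum psumM ncycles_psum /nfaces.
by congr (nat_of_bool (_ == _)); lia.
Qed.

(** Adding the Euler relations of the two pieces, of genera [h1] and [h2], shows that the condition
    means [h1 + h2 = g.+1]; hence at most one index [g1] contributes for each pair. *)
Lemma sum_faces_genus (i j g : nat) :
  (\sum_(s : {perm 'I_(2 * i)} | fpf_involution s) \sum_(t : {perm 'I_(2 * j)} | fpf_involution t)
      (i + j == 2 * g + (nfaces s + nfaces t)))%N
  = (\sum_(g1 < g.+2) c1 g1 i * c1 (g.+1 - g1) j)%N.
Proof.
transitivity (\sum_(g1 < g.+2) \sum_(s : {perm 'I_(2 * i)} | fpf_involution s)
    \sum_(t : {perm 'I_(2 * j)} | fpf_involution t)
      (i.+1 == 2 * g1 + nfaces s) * (j.+1 == 2 * (g.+1 - g1) + nfaces t))%N; last first.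
  apply: eq_bigr => g1 _; rewrite !c1_genus_count /genus_count big_distrl /=.
  by apply: eq_bigr => s _; rewrite big_distrr.
rewrite [RHS]exchange_big; apply: eq_bigr => s /nfaces_euler[h1 E1] /=.
rewrite [RHS]exchange_big; apply: eq_bigr => t /nfaces_euler[h2 E2] /=.
have [h1g|h1g] := ltnP h1 g.+2.
  rewrite (bigD1 (Ordinal h1g)) //= big1 => [|g1 g1h]; last first.
    rewrite (_ : (i.+1 == _) = false) //; apply/negbTE; apply: contraNneq g1h => E.
    by rewrite -val_eqE /=; apply/eqP; lia.
  by rewrite E1 eqxx mul1n addn0; congr nat_of_bool; apply/eqP/eqP; lia.
rewrite big1 => [|g1 _]; first by case: eqP => //; lia.
rewrite (_ : (i.+1 == _) = false) //; apply/negbTE/eqP; have := ltn_ord g1; lia.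
Qed.

Lemma big_ord_even (F : nat -> nat) n : (forall k, odd k -> F k = 0%N) ->
  (\sum_(k < (2 * n).+1) F k = \sum_(i < n.+1) F (2 * i))%N.
Proof.
move=> F0; elim: n => [|n IH]; first by rewrite !big_ord1.
rewrite big_ord_recr [RHS]big_ord_recr /= -IH (_ : 2 * n.+1 = (2 * n).+2)%N; last by lia.
by rewrite big_ord_recr /= [F (2 * n).+1]F0 ?addn0 //=; lia.
Qed.

Lemma big_nat_drop_last (F : nat -> nat) m : F m = 0%N ->
  (\sum_(1 <= k < m.+1) F k = \sum_(1 <= k < m) F k)%N.
Proof. by case: m => [|m] Fm; [rewrite !big_geq | rewrite big_nat_recr //= Fm addn0]. Qed.

(* Deleting the chord at the first point cuts the backbone into two pieces. *)
Lemma cut_recursion g n :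
  c1 g.+1 n.+1
  = (c2 g n + \sum_(g1 < g.+2) \sum_(i < n.+1) c1 g1 i * c1 (g.+1 - g1) (n - i))%N.
Proof.
set m := (2 * n)%N.
(* The relation [n.+2 = 2 * g.+1 + r] loses 2 on both sides; an empty piece adds one to [r]. *)
pose X (k : nat) (s : {perm 'I_m}) : nat :=
  (n == 2 * g + (ncycles (s * tau k m)%g + (k == 0) + (m - k == 0)))%N.
have -> : c1 g.+1 n.+1 = (\sum_(k < m.+1) \sum_(s : {perm 'I_m} | fpf_involution s) X k s)%N.
  rewrite c1_genus_count (_ : 2 * n.+1 = m.+2)%N; last by rewrite /m; lia.
  rewrite /genus_count sum_ins_chord; apply: eq_bigr => k _; apply: eq_bigr => s _.
  rewrite /X /nfaces ncycles_ins_chord (_ : (m - k == 0)%N = (k == m :> nat)).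
    by congr nat_of_bool; apply/eqP/eqP; lia.
  by rewrite subn_eq0; have := ltn_ord k; case: eqP; lia.
(* The cuts [k = 0] and [k = m] admit no connecting chord, so they can be added to the range of
   [c2]. *)
have -> : c2 g n = (\sum_(k < m.+1)
    \sum_(s : {perm 'I_m} | fpf_involution s && connected2 k s) X k s)%N.
  pose F k := (\sum_(s : {perm 'I_m} | fpf_involution s && connected2 k s) X k s)%N.
  have F0 : F 0%N = 0%N.
    rewrite /F big1 // => s /andP[_ /existsP[x]]; by rewrite ltn0.
  have Fm : F m = 0%N.
    rewrite /F big1 // => s /andP[_ /existsP[x]].
    by rewrite [X in _ && X]leqNgt !ltn_ord.
  rewrite -(big_mkord xpredT F) big_ltn // F0 add0n.
  transitivity (\sum_(1 <= k < m) F k)%N; last first.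
    by rewrite big_nat_drop_last.
  rewrite /c2; apply: eq_big_nat => k /andP[k0 km]; rewrite /F.
  rewrite -sum1dep_card big_mkcond [RHS]big_mkcond; apply: eq_bigr => s _ /=.
  have kn0 : (k == 0)%N = false by lia.
  have mkn0 : (m - k == 0)%N = false by lia.
  rewrite /X kn0 mkn0 !addn0.
  by case: (fpf_involution s); case: (connected2 k s); case: eqP.
transitivity (\sum_(k < m.+1) \sum_(s : {perm 'I_m} | fpf_involution s && connected2 k s) X k s
  + \sum_(k < m.+1) \sum_(s : {perm 'I_m} | fpf_involution s && ~~ connected2 k s) X k s)%N.
  rewrite -big_split; apply: eq_bigr => k _ /=.
  by rewrite (bigID (fun s => connected2 k s)).
congr (_ + _)%N.
pose G k := (\sum_(s : {perm 'I_k} | fpf_involution s)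
  \sum_(t : {perm 'I_(m - k)} | fpf_involution t) (n == 2 * g + (nfaces s + nfaces t)))%N.
transitivity (\sum_(k < m.+1) G k)%N.
  apply: eq_bigr => k _; apply: sum_disconnected_faces.
  by rewrite subnKC // -ltnS.
(* A piece with an odd number of points has no pairing. *)
rewrite big_ord_even => [|k ok]; last by rewrite /G big_pred0 // => s; apply: fpf_odd_false.
rewrite exchange_big; apply: eq_bigr => i _ /=; have := ltn_ord i => li.
rewrite -sum_faces_genus /G /m -mulnBr subnKC //.
Qed.

(** * Powers of [1 - 4z] *)

Definition fps_pow14 (a : rat) : fps := pow14 a.

Lemma pow14_0 a : pow14 a 0 = 1.
Proof. by rewrite /pow14 /gbinom big_ord0. Qed.

Lemma pow14S a j : j.+1%:R * pow14 a j.+1 = -4 * (a - j%:R) * pow14 a j.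
Proof.
rewrite /pow14 /gbinom big_ord_recr /= factS natrM exprS.
have f0 : (j`!)%:R != 0 :> rat by rewrite pnatr_eq0 -lt0n fact_gt0.
have j0 : j.+1%:R != 0 :> rat by rewrite pnatr_eq0.
move: (\prod_(i < j) _) ((-4) ^+ j) => p e.
rewrite invfM; transitivity (-4 * (a - j%:R) * (p / (j`!)%:R * e) * (j.+1%:R / j.+1%:R)).
  by ring.
by rewrite mulfV // mulr1.
Qed.

Lemma theta_pow14 a :
  (1 - 4%:R * fpsX) * fps_theta (fps_pow14 a) = fps_poly (-4 * a)%:P * (fpsX * fps_pow14 a).
Proof.
apply/funext => n; rewrite mulrBl mul1r -mulrA fpsB fps_natM fps_polyC !fpsXM /fps_theta.
case: n => [|n]; first by rewrite mul0r !mulr0 subr0.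
by rewrite /fps_pow14 pow14S; ring.
Qed.

(** The equation determines each coefficient from the previous one. It gives the exponent law of
    [fps_pow14], in place of a Vandermonde identity with rational upper arguments. *)
Lemma theta_eq_unique (f h : fps) c : f 0%N = h 0%N ->
  (1 - 4%:R * fpsX) * fps_theta f = fps_poly c%:P * (fpsX * f) ->
  (1 - 4%:R * fpsX) * fps_theta h = fps_poly c%:P * (fpsX * h) -> f = h.
Proof.
move=> fh0 Ef Eh; apply/funext; elim=> [|n IH] //.
have := congr1 (fun u => u n.+1) Eh; have := congr1 (fun u => u n.+1) Ef.
rewrite /= !mulrBl !mul1r -!mulrA !fpsB !fps_natM !fps_polyC !fpsXM /fps_theta IH => <-.
by move/addIr/mulfI => -> //; rewrite pnatr_eq0.
Qed.

Lemma fps_pow14D a b : fps_pow14 a * fps_pow14 b = fps_pow14 (a + b).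
Proof.
apply: (theta_eq_unique (c := -4 * (a + b))); last exact: theta_pow14.
  by rewrite fpsM big_ord1 /fps_pow14 !pow14_0 mulr1.
rewrite fps_thetaM mulrDr [X in X + _]mulrA theta_pow14 [X in _ + X]mulrCA theta_pow14 mulrDr polyCD rmorphD /=.
by move: (fps_poly _) (fps_poly _) => u v; ring.
Qed.

Lemma pow14_nat (k j : nat) : pow14 k%:R j = 'C(k, j)%:R * (-4) ^+ j.
Proof.
rewrite /pow14 /gbinom prod_falling -bin_ffact natrM mulfK //.
by rewrite pnatr_eq0 -lt0n fact_gt0.
Qed.

Lemma fps_pow14_nat k : fps_pow14 k%:R = (1 - 4%:R * fpsX) ^+ k.
Proof.
elim: k => [|k IH].
  apply/funext => n; rewrite expr0 fps1 /fps_pow14 pow14_nat bin0n.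
  by case: n => [|n]; rewrite ?expr0 ?mul0r ?mulr1.
rewrite exprS -{}IH -natr1 addrC -fps_pow14D; congr (_ * _); apply/funext => n.
rewrite fpsB fps_natM fps1 /fpsX /fps_pow14 (pow14_nat 1).
by case: n => [|[|n]]; rewrite ?bin0 ?binn ?bin_small ?expr0 ?expr1 ?mul0r ?mulr0 ?subr0 //.
Qed.

Lemma pow14_half_den (k j : nat) :
  pow14 (- k%:R - 2^-1) j
  = ((2 * (k + j))`!)%:R * (k`!)%:R / (((k + j)`!)%:R * ((2 * k)`!)%:R * (j`!)%:R).
Proof.
have f0 n : (n`!)%:R != 0 :> rat by rewrite pnatr_eq0 -lt0n fact_gt0.
elim: j => [|j IH].
  rewrite pow14_0 addn0 fact0 mulr1 [X in _ / X]mulrC mulfV //.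
  by rewrite mulf_neq0.
have j0 : j.+1%:R != 0 :> rat by rewrite pnatr_eq0.
have kj0 : (k + j).+1%:R != 0 :> rat by rewrite pnatr_eq0.
apply: (mulfI j0); rewrite pow14S IH addnS (_ : 2 * (k + j).+1 = (2 * (k + j)).+2)%N; last by lia.
rewrite !factS !natrM.
have -> : (2 * (k + j)).+2%:R = 2%:R * (k + j).+1%:R :> rat by rewrite -natrM; congr _%:R; lia.
have -> : (2 * (k + j)).+1%:R = 2%:R * k%:R + 2%:R * j%:R + 1 :> rat.
  by rewrite -[LHS]natr1 mulnDr natrD !natrM.
by field; rewrite !f0 -natrD ![1 + _]addrC !natr1 j0 kj0.
Qed.

Lemma pow14_neg_nat (d n : nat) : pow14 (- d.+1%:R) n = 'C(n + d, d)%:R * 4 ^+ n.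
Proof.
elim: n => [|n IH]; first by rewrite pow14_0 add0n binn mulr1.
have n0 : n.+1%:R != 0 :> rat by rewrite pnatr_eq0.
have B : n.+1%:R * 'C(n.+1 + d, d)%:R = (n + d).+1%:R * 'C(n + d, d)%:R :> rat.
  rewrite -!natrM addSn [in RHS](mul_bin_down (n + d).+1); congr (_ * _)%:R; lia.
apply: (mulfI n0); rewrite pow14S IH exprS [RHS]mulrA B.
by rewrite -[(n + d).+1%:R]natr1 natrD -[d.+1%:R]natr1; ring.
Qed.

(** * One-backbone series *)

(* [genus_coef g k] is the coefficient of [x^k] in the polynomial [B] such that
   [sum_n c_(g+1)(n) n! / (2n)! x^n = B e^x]. *)
Fixpoint genus_coef (g k : nat) : rat :=
  if g is g'.+1 then
    (k.-1%:R * (if (2 <= k)%N then genus_coef g' (k - 2) else 0)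
     + (if (3 <= k)%N then genus_coef g' (k - 3) else 0)) / (4 * k.+1)%:R
  else if k == 2 then 12^-1 else 0.

Lemma genus_coefS g k : genus_coef g.+1 k =
  (k.-1%:R * (if (2 <= k)%N then genus_coef g (k - 2) else 0)
   + (if (3 <= k)%N then genus_coef g (k - 3) else 0)) / (4 * k.+1)%:R.
Proof. by []. Qed.

Lemma genus_coef_supp g k :
  genus_coef g k != 0 -> ((2 * g.+1 <= k) && (k <= 3 * g + 2))%N.
Proof.
elim: g k => [|g IH] k /=; first by have [->|] := eqVneq k 2; rewrite ?eqxx.
have [E2|/IH /andP[a b] _] := eqVneq (genus_coef g (k - 2)) 0; last by lia.
have [E3|/IH /andP[a b] _] := eqVneq (genus_coef g (k - 3)) 0; last by lia.
by rewrite E2 E3 !if_same mulr0 addr0 mul0r eqxx.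
Qed.

Lemma genus_coef_low g : genus_coef g (2 * g.+1) = ((4 ^ g.+1 * (2 * g + 3))%:R)^-1.
Proof.
elim: g => [|g IH] //; rewrite genus_coefS.
have -> : (2 * g.+2 - 2 = 2 * g.+1)%N by lia.
have h2 : (1 < 2 * g.+2)%N by lia.
have h3 : (2 < 2 * g.+2)%N by lia.
rewrite h2 h3.
have -> : genus_coef g (2 * g.+2 - 3) = 0.
  by apply: contraTeq isT => /genus_coef_supp; lia.
rewrite IH addr0 (_ : (2 * g.+2).-1 = 2 * g + 3)%N; last by lia.
have x0 : (2 * g + 3)%:R != 0 :> rat by rewrite pnatr_eq0; lia.
rewrite [(4 ^ g.+1 * _)%:R]natrM [((4 ^ g.+1)%:R * _)^-1]invfM mulrCA mulfV // mulr1 -invfM -natrM.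
by congr (_%:R^-1); rewrite [in RHS]expnS; lia.
Qed.

Lemma genus_coef_top g :
  genus_coef g.+1 (3 * g.+1 + 2) = genus_coef g (3 * g + 2) / (12 * g.+2)%:R.
Proof.
rewrite genus_coefS; have -> : (3 * g.+1 + 2 - 3 = 3 * g + 2)%N by lia.
have -> : genus_coef g (3 * g.+1 + 2 - 2) = 0.
  by apply: contraTeq isT => /genus_coef_supp; lia.
rewrite if_same mulr0 add0r (_ : (2 < _)%N = true); last by lia.
by congr (_ / _%:R); lia.
Qed.

(** The derivative of [x * f]. *)
Definition theta1 (f : fps) : fps := fps_theta f + f.
Definition fps_exp : fps := fun n => (n`!%:R)^-1.
(** By [fpf_countE] the coefficient is [c_g(n) n! / (2n)!]. *)
Definition c1_egf (g : nat) : fps := fun n => c1_avg g n / 2 ^+ n.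

Lemma theta1E f n : theta1 f n = n.+1%:R * f n.
Proof. by rewrite /theta1 fpsD /fps_theta -natr1 mulrDl mul1r. Qed.

Lemma theta1_unique (f h r : fps) :
  4%:R * theta1 f = 4%:R * (fpsX * f) + r -> 4%:R * theta1 h = 4%:R * (fpsX * h) + r -> f = h.
Proof.
move=> Ef Eh; apply/funext => n; elim: n => [|n IH].
  have := congr1 (fun u => u 0%N) Eh; have := congr1 (fun u => u 0%N) Ef.
  rewrite /= !fpsD !fps_natM !fpsXM !theta1E => <-.
  by move/mulfI => /(_ isT)/mulfI -> .
have := congr1 (fun u => u n.+1) Eh; have := congr1 (fun u => u n.+1) Ef.
rewrite /= !fpsD !fps_natM !fpsXM !theta1E IH => <-.
by move/mulfI => /(_ isT)/mulfI -> //; rewrite pnatr_eq0.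
Qed.

Lemma c1_egf_genusS g :
  4%:R * theta1 (c1_egf g.+1) = 4%:R * (fpsX * c1_egf g.+1) + fpsX ^+ 2 * theta1 (c1_egf g).
Proof.
have [_ c0 c1'] := c1_avg_init g.
apply/funext => n; rewrite fpsD !fps_natM theta1E fpsXM fpsXnM /c1_egf.
case: n => [|[|n]] /=; first by rewrite c0 mul0r !mulr0 addr0.
  by rewrite c0 c1' !mul0r !mulr0 addr0.
rewrite theta1E /c1_egf subSS subSS subn0 [n.+3%:R * _]mulrA c1_avg_genusS !exprS.
have e0 : 2 ^+ n != 0 :> rat by rewrite expf_neq0.
by field.
Qed.

Lemma theta1_c1_egf0 : theta1 (c1_egf 0) = fps_exp.
Proof.
apply/funext => n; rewrite theta1E /fps_exp /c1_egf.
suff -> : c1_avg 0 n = 2 ^+ n / (n.+1`!)%:R.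
  have e0 : 2 ^+ n != 0 :> rat by rewrite expf_neq0.
  have n0 : n.+1%:R != 0 :> rat by rewrite pnatr_eq0.
  by rewrite [2 ^+ n / _ / _]mulrAC mulfV // mul1r factS natrM invfM mulrA mulfV // mul1r.
elim: n => [|n IH]; first by have [-> _ _] := c1_avg_init 0; rewrite divr1.
have n0 : n.+2%:R != 0 :> rat by rewrite pnatr_eq0.
apply: (mulfI n0); rewrite c1_avg_genus0 IH (factS n.+1) natrM exprS invfM.
by rewrite [RHS]mulrCA [n.+2%:R * _]mulrA mulfV // mul1r mulrA.
Qed.

Lemma theta_fps_exp : fps_theta fps_exp = fpsX * fps_exp.
Proof.
apply/funext => n; rewrite fpsXM /fps_theta /fps_exp; case: n => [|n]; first by rewrite mul0r.
by rewrite factS natrM invfM mulrA mulfV ?mul1r // pnatr_eq0.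
Qed.

Lemma theta1_mul_exp (f : fps) :
  theta1 (f * fps_exp) = (theta1 f + fpsX * f) * fps_exp.
Proof. by rewrite /theta1 fps_thetaM theta_fps_exp; ring. Qed.

(** Substituting [B * fps_exp] in [c1_egf_genusS] cancels the term [4 x B] and leaves [4 theta1
    B_(g+1) = x^2 (theta1 B_g + x B_g)], whose coefficients are the recursion of [genus_coef]. In
    genus 1 the right side is [x^2], whence the constant [1/12 = 1/(4 * 3)]. *)
Lemma c1_egfE g : c1_egf g.+1 = (genus_coef g : fps) * fps_exp.
Proof.
elim: g => [|g IH]; apply: (theta1_unique (c1_egf_genusS _)).
  rewrite theta1_c1_egf0 theta1_mul_exp.
  have -> : fpsX ^+ 2 = 4%:R * theta1 (genus_coef 0).
    apply/funext => n; rewrite fps_natM theta1E -[fpsX ^+ 2]mulr1 fpsXnM fps1 /=.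
    case: n => [|[|[|n]]]; rewrite ?mulr0 //.
  by ring.
have E : 4%:R * theta1 (genus_coef g.+1)
    = fpsX ^+ 2 * (theta1 (genus_coef g) + fpsX * (genus_coef g : fps)).
  apply/funext => k; rewrite fps_natM theta1E /= fpsXnM fpsD theta1E fpsXM.
  rewrite mulrA -natrM mulrC mulfVK ?pnatr_eq0 //.
  case: k => [|[|[|k]]]; rewrite /= ?mulr0 ?mul0r ?addr0 //.
  by rewrite !subSS !subn0.
by rewrite IH !theta1_mul_exp [fpsX ^+ 2 * _]mulrA -E; ring.
Qed.

Definition c1_series (g : nat) : fps := fun n => (c1 g n)%:R.

Lemma c1_egf_fact g n : c1_series g n = c1_egf g n * ((2 * n)`!)%:R / (n`!)%:R.
Proof.
rewrite /c1_series /c1_egf /c1_avg -(fpf_countE n) !natrM natrX.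
have f0 : (n`!)%:R != 0 :> rat by rewrite pnatr_eq0 -lt0n fact_gt0.
have e0 : 2 ^+ n != 0 :> rat by rewrite expf_neq0.
have c0 := fpf_count_neq0 n.
by move: (fpf_count _)%:R c0 => c c0; field; rewrite c0 e0 f0.
Qed.

Lemma sum_ord_supp (R : nmodType) (F : nat -> R) (A n : nat) :
  (forall k, (A <= k)%N -> F k = 0) ->
  \sum_(k < A) (if (k <= n)%N then F k else 0) = \sum_(k < n.+1) F k.
Proof.
move=> F0; rewrite (big_ord_widen (A + n.+1) (fun k => if (k <= n)%N then F k else 0)) ?leq_addr //.
rewrite [RHS](big_ord_widen (A + n.+1)) ?leq_addl // big_mkcond [RHS]big_mkcond.
apply: eq_bigr => k _; rewrite ltnS; have [Ak|Ak //] := leqP A k.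
by rewrite F0 // if_same.
Qed.

Definition P_coef (g k : nat) : rat := genus_coef g k * ((2 * k)`!)%:R / (k`!)%:R.

Lemma c1_seriesE g : c1_series g.+1
  = \sum_(k < 3 * g + 3) fps_poly (P_coef g k)%:P * (fpsX ^+ k * fps_pow14 (- k%:R - 2^-1)).
Proof.
apply/funext => n; rewrite c1_egf_fact c1_egfE fpsM fps_sum mulr_suml mulr_suml.
pose F k := P_coef g k * pow14 (- k%:R - 2^-1) (n - k).
transitivity (\sum_(k < 3 * g + 3) (if (k <= n)%N then F k else 0)); last first.
  by apply: eq_bigr => k _; rewrite fps_polyC fpsXnM; case: ifP; rewrite ?mulr0.
rewrite sum_ord_supp => [|k hk]; last first.
  rewrite /F /P_coef (_ : genus_coef g k = 0) ?mul0r //.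
  by apply: contraTeq isT => /genus_coef_supp; lia.
apply: eq_bigr => k _; have kn : (k <= n)%N by have := ltn_ord k; lia.
rewrite /F /P_coef pow14_half_den subnKC // /fps_exp.
have f0 m : (m`!)%:R != 0 :> rat by rewrite pnatr_eq0 -lt0n fact_gt0.
by field; rewrite !f0.
Qed.

(** This is [P_(g+1)]: the index is shifted by one, as in [genus_coef]. The exponent is
    [3(g+1) - 1/2 - (k + 1/2)]. *)
Definition P_poly (g : nat) : {poly rat} :=
  \sum_(k < 3 * g + 3) P_coef g k *: ('X^k * (1 - 4%:P * 'X) ^+ (3 * g + 2 - k)).

Lemma fps_poly_14 k : fps_poly ((1 - 4%:P * 'X) ^+ k) = (1 - 4%:R * fpsX) ^+ k.
Proof.
rewrite rmorphXn rmorphB rmorphM rmorph1 /= fps_polyX.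
by rewrite -[fps_poly 4%:P]/((fps_poly \o polyC) 4%:R) rmorph_nat.
Qed.

Lemma P_polyE g :
  c1_series g.+1 * fps_pow14 ((3 * g.+1)%:R - 2^-1) = fps_poly (P_poly g).
Proof.
rewrite c1_seriesE mulr_suml rmorph_sum; apply: eq_bigr => k _.
rewrite -mul_polyC !rmorphM rmorphXn /= fps_polyX fps_poly_14 -!mulrA fps_pow14D.
have kg : (k <= 3 * g + 2)%N by have := ltn_ord k; lia.
have -> : - k%:R - 2^-1 + ((3 * g.+1)%:R - 2^-1) = (3 * g + 2 - k)%:R :> rat.
  by rewrite natrB // natrD mulnS natrD; lra.
by rewrite fps_pow14_nat.
Qed.

Lemma Pcoef_P_poly g k : Pcoef g.+1 k = (P_poly g)`_k.
Proof. by rewrite -[RHS]/(fps_poly (P_poly g) k) -P_polyE. Qed.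

Lemma coef_P_poly_low g h : (h < 2 * g.+1)%N -> (P_poly g)`_h = 0.
Proof.
move=> hg; rewrite coef_sum big1 // => k _; rewrite coefZ coefXnM.
case: ltnP => [_|kh]; first by rewrite mulr0.
rewrite /P_coef (_ : genus_coef g k = 0) ?mul0r //.
by apply: contraTeq isT => /genus_coef_supp; lia.
Qed.

Lemma size_14_exp m : (size ((1 - 4%:P * 'X : {poly rat}) ^+ m)%R <= m.+1)%N.
Proof.
have s2 : (size (1 - 4%:P * 'X : {poly rat})%R <= 2)%N.
  rewrite (leq_trans (size_polyD _ _)) // geq_max size_poly1 /= size_polyN mul_polyC.
  by rewrite (leq_trans (size_scale_leq _ _)) // size_polyX.
apply: leq_trans (size_poly_exp_leq _ _) _; rewrite ltnS.
by rewrite -[X in (_ <= X)%N]mul1n leq_mul2r; move: s2; case: (size _) => [|[|s]] //= s2; rewrite ?orbT //; case: m.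
Qed.

Lemma size_P_poly g : (size (P_poly g) <= 3 * g + 3)%N.
Proof.
apply: (leq_trans (size_sum _ _ _)); apply/bigmax_leqP => k _.
apply: (leq_trans (size_scale_leq _ _)); apply: (leq_trans (size_polyMleq _ _)).
rewrite size_polyXn; have := size_14_exp (3 * g + 2 - k); have := ltn_ord k.
by move: (size _) => s; lia.
Qed.

(** * The values at 1/4 and their log-convexity *)

Definition P_top (g : nat) : rat := (P_poly g).[4^-1].

Lemma P_topE g : P_top g = P_coef g (3 * g + 2) / 4 ^+ (3 * g + 2).
Proof.
have l : (3 * g + 2 < 3 * g + 3)%N by lia.
rewrite /P_top horner_sum (bigD1 (Ordinal l)) //= big1 => [|k kl].
  by rewrite addr0 subnn expr0 mulr1 hornerZ hornerXn exprVn.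
have lk : (0 < 3 * g + 2 - k)%N.
  rewrite subn_gt0 ltn_neqAle -[X in _ && X]ltnS -addnS ltn_ord andbT.
  by apply: contraNneq kl => E; apply/eqP/val_inj.
rewrite hornerZ hornerM hornerXn horner_exp hornerD hornerN hornerM !hornerC hornerX.
by rewrite mulfV // subrr expr0n eqn0Ngt lk !mulr0.
Qed.

Lemma P_top0 : P_top 0 = 16^-1. Proof. by rewrite P_topE. Qed.

(** With [k = 3g + 2], the factorials contribute [8 (2k+1)(2k+3)(2k+5)], while [genus_coef_top]
    divides by [12 (g+2)] and the power of 4 by 64; [96 = 12 * 64 / 8]. *)
Definition P_top_ratio (g : nat) : rat :=
  (6 * g%:R + 5) * (6 * g%:R + 7) * (6 * g%:R + 9) / (96 * (g%:R + 2)).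

Lemma P_topS g : P_top g.+1 = P_top_ratio g * P_top g.
Proof.
have g0 : 0 <= g%:R :> rat by rewrite ler0n.
rewrite !P_topE /P_coef genus_coef_top; set k := (3 * g + 2)%N.
have -> : (3 * g.+1 + 2 = k.+3)%N by lia.
have -> : (2 * k.+3 = (2 * k).+4.+2)%N by lia.
have f0 n : (n`!)%:R != 0 :> rat by rewrite pnatr_eq0 -lt0n fact_gt0.
have e0 : 4 ^+ k != 0 :> rat by rewrite expf_neq0.
have k1 : k.+1%:R = 3 * g%:R + 3 :> rat by rewrite -natrM -natrD; congr _%:R; lia.
have k2 : k.+2%:R = 3 * g%:R + 4 :> rat by rewrite -natrM -natrD; congr _%:R; lia.
have k3 : k.+3%:R = 3 * g%:R + 5 :> rat by rewrite -natrM -natrD; congr _%:R; lia.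
have K1 : (2 * k).+1%:R = 6 * g%:R + 5 :> rat by rewrite -natrM -natrD; congr _%:R; lia.
have K2 : (2 * k).+2%:R = 6 * g%:R + 6 :> rat by rewrite -natrM -natrD; congr _%:R; lia.
have K3 : (2 * k).+3%:R = 6 * g%:R + 7 :> rat by rewrite -natrM -natrD; congr _%:R; lia.
have K4 : (2 * k).+4%:R = 6 * g%:R + 8 :> rat by rewrite -natrM -natrD; congr _%:R; lia.
have K5 : (2 * k).+4.+1%:R = 6 * g%:R + 9 :> rat by rewrite -natrM -natrD; congr _%:R; lia.
have K6 : (2 * k).+4.+2%:R = 6 * g%:R + 10 :> rat by rewrite -natrM -natrD; congr _%:R; lia.
have G : (12 * g.+2)%:R = 12 * (g%:R + 2) :> rat by rewrite -natrD -natrM; congr _%:R; lia.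
have -> : ((2 * k).+4.+2`!)%:R = (6 * g%:R + 10) * ((6 * g%:R + 9) * ((6 * g%:R + 8) *
    ((6 * g%:R + 7) * ((6 * g%:R + 6) * ((6 * g%:R + 5) * ((2 * k)`!)%:R))))) :> rat.
  by rewrite 6!factS 6!natrM K1 K2 K3 K4 K5 K6.
have -> : (k.+3`!)%:R = (3 * g%:R + 5) * ((3 * g%:R + 4) * ((3 * g%:R + 3) * (k`!)%:R)) :> rat.
  by rewrite 3!factS 3!natrM k1 k2 k3.
rewrite G /P_top_ratio 3!exprS.
move: ((2 * k)`!%:R : rat) (f0 (2 * k)%N) => x x0; move: (k`!%:R : rat) (f0 k) => y y0.
move: (4 ^+ k) e0 (genus_coef g k) (g%:R : rat) g0 => e e0 b t t0.
by field; rewrite e0 y0 /=; apply/and4P; split; apply: lt0r_neq0; lra.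
Qed.

Lemma P_top_ratio_gt0 g : 0 < P_top_ratio g.
Proof.
have g0 : 0 <= g%:R :> rat by rewrite ler0n.
apply: divr_gt0; last by lra.
by apply: mulr_gt0; [apply: mulr_gt0|]; lra.
Qed.

Lemma P_top_ratioS g : P_top_ratio g <= P_top_ratio g.+1.
Proof.
have g0 : 0 <= g%:R :> rat by rewrite ler0n.
rewrite /P_top_ratio -[g.+1%:R]natr1; move: (g%:R : rat) g0 => t t0.
rewrite -subr_ge0.
have -> : (6 * (t + 1) + 5) * (6 * (t + 1) + 7) * (6 * (t + 1) + 9) / (96 * (t + 1 + 2))
    - (6 * t + 5) * (6 * t + 7) * (6 * t + 9) / (96 * (t + 2))
    = (432 * t ^+ 3 + 2700 * t ^+ 2 + 5292 * t + 3345) / (96 * ((t + 3) * (t + 2))).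
  by field; apply/andP; split; apply: lt0r_neq0; lra.
have t2 : 0 <= t ^+ 2 by apply: exprn_ge0.
have t3 : 0 <= t ^+ 3 by apply: exprn_ge0.
apply: divr_ge0; first by lra.
by apply: mulr_ge0 => //; apply: mulr_ge0; lra.
Qed.

Lemma P_top_gt0 g : 0 < P_top g.
Proof.
elim: g => [|g IH]; first by rewrite P_top0.
by rewrite P_topS mulr_gt0 // P_top_ratio_gt0.
Qed.

Lemma P_top_ratio_mono j k : P_top_ratio j <= P_top_ratio (j + k).
Proof.
elim: k => [|k IHk]; first by rewrite addn0 lexx.
rewrite addnS; exact: le_trans IHk (P_top_ratioS _).
Qed.

Lemma P_top_log_convex j k : P_top j * P_top k <= P_top 0 * P_top (j + k).
Proof.
elim: j => [|j IH]; first exact: lexx.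
rewrite addSn !P_topS -mulrA [leRHS]mulrCA.
apply: (le_trans (ler_wpM2l (ltW (P_top_ratio_gt0 j)) IH)).
apply: ler_wpM2r (P_top_ratio_mono j k).
by rewrite mulr_ge0 ?ltW ?P_top_gt0.
Qed.

(** Log-convexity bounds each of the [g] terms by [P_top 0 * P_top g.-1]. The number of terms grows
    linearly, the ratio of consecutive [P_top] quadratically. *)
Lemma P_top_conv g : \sum_(i < g) P_top i * P_top (g.-1 - i) < 4%:R * P_top g.
Proof.
case: g => [|g].
  by rewrite big_ord0; apply: mulr_gt0 (P_top_gt0 0).
have le (i : 'I_g.+1) : P_top i * P_top (g.+1.-1 - i) <= P_top 0 * P_top g.
  have := P_top_log_convex i (g - i); rewrite subnKC; last by rewrite -ltnS.
  exact.
apply: (le_lt_trans (ler_sum _ (fun i _ => le i))).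
rewrite sumr_const card_ord -[ltLHS]mulr_natr P_topS mulrA mulrAC.
(* It remains that [(g + 1) / 16 < 4 * P_top_ratio g]; with cleared denominators the difference is a
   cubic with positive coefficients. *)
rewrite ltr_pM2r ?P_top_gt0 // P_top0 /P_top_ratio -[g.+1%:R]natr1.
have g0 : 0 <= g%:R :> rat by rewrite ler0n.
move: (g%:R : rat) g0 {le} => t t0.
rewrite mulrA ltr_pdivlMr; last by lra.
have t2 : 0 <= t ^+ 2 by apply: exprn_ge0.
have t3 : 0 <= t ^+ 3 by apply: exprn_ge0.
rewrite -subr_gt0.
have -> : 4 * ((6 * t + 5) * (6 * t + 7) * (6 * t + 9)) - 16^-1 * (t + 1) * (96 * (t + 2))
   = 864 * t ^+ 3 + 3018 * t ^+ 2 + 3414 * t + 1248 by field.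
lra.
Qed.

(** * Two-backbone series *)

Definition c2_series (g : nat) : fps := fun n => (c2 g n)%:R.

Definition S_poly (g : nat) : {poly rat} := \sum_(i < g) P_poly i * P_poly (g.-1 - i).

Lemma c1_series_cut g : c1_series g.+1
  = fpsX * (c2_series g + \sum_(i < g.+2) c1_series i * c1_series (g.+1 - i)).
Proof.
apply/funext => n; rewrite fpsXM; case: n => [|n] //.
rewrite fpsD fps_sum /c1_series cut_recursion natrD; congr (_ + _).
by rewrite natr_sum; apply: eq_bigr => i _; rewrite fpsM natr_sum; apply: eq_bigr => j _; rewrite natrM.
Qed.

Lemma c1_genus0_step n : n.+2%:R * (c1 0 n.+1)%:R = 2 * (2 * n%:R + 1) * (c1 0 n)%:R :> rat.
Proof.
have E k : (c1 0 k)%:R = c1_avg 0 k * (fpf_count (2 * k))%:R.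
  by rewrite /c1_avg mulfVK // fpf_count_neq0.
rewrite !E mulrA c1_avg_genus0 (_ : 2 * n.+1 = (2 * n).+2)%N; last by lia.
by rewrite fpf_countSS natrM -[(2 * n).+1%:R]natr1 natrM; ring.
Qed.

(** In genus 0 the recursion has only one lower term, and the coefficients of the square root
    satisfy the same first-order recursion. *)
Lemma catalan_pow14 : 1 - 2%:R * fpsX * c1_series 0 = fps_pow14 2^-1.
Proof.
have c00 : (c1 0 0)%:R = 1 :> rat by [].
apply/funext => n; rewrite fpsB fps1 -mulrA fps_natM fpsXM.
case: n => [|n]; first by rewrite mulr0 subr0 /fps_pow14 pow14_0.
rewrite sub0r /c1_series /fps_pow14; elim: n => [|n IH].
  by rewrite c00 /pow14 /gbinom big_ord1.
have n0 : n.+2%:R != 0 :> rat by rewrite pnatr_eq0.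
apply: (mulfI n0); rewrite pow14S -IH mulrN mulrCA c1_genus0_step -[n.+1%:R]natr1.
by field.
Qed.

(** The two extreme terms of the convolution are both [C_0 C_(g+1)]; moved to the other side they
    give the factor [1 - 2 z C_0]. *)
Lemma c2_series_cut g : fpsX * c2_series g
  = fps_pow14 2^-1 * c1_series g.+1
    - fpsX * \sum_(i < g) c1_series i.+1 * c1_series (g.-1 - i).+1.
Proof.
rewrite -catalan_pow14 mulrBl mul1r {1}c1_series_cut big_ord_recl big_ord_recr /=.
rewrite subn0 [bump 0 g]/bump /= add1n subnn.
rewrite (eq_bigr (fun i : 'I_g => c1_series i.+1 * c1_series (g.-1 - i).+1)); last first.
  move=> i _; rewrite /bump /= add1n; congr (c1_series _ * c1_series _).
  by have := ltn_ord i; lia.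
by ring.
Qed.

(** The half-integers cancel: [1/2 + 3g + 2 = 3(g+1) - 1/2], and two exponents [3a - 1/2] and
    [3b - 1/2] with [a + b = g + 1] add up to [3g + 2]. *)
Lemma c2_seriesE g : fpsX * (c2_series g * fps_pow14 (3 * g + 2)%:R)
  = fps_poly (P_poly g - 'X * S_poly g).
Proof.
rewrite mulrA c2_series_cut mulrBl rmorphB rmorphM /= fps_polyX; congr (_ - _).
  rewrite -P_polyE mulrAC fps_pow14D mulrC; congr (_ * fps_pow14 _).
  by rewrite natrD mulnS natrD; lra.
rewrite -mulrA; congr (_ * _); rewrite mulr_suml rmorph_sum; apply: eq_bigr => i _.
rewrite rmorphM /= -!P_polyE mulrACA fps_pow14D; congr (_ * fps_pow14 _).
have -> : (3 * g + 2 = 3 * i.+1 + 3 * (g.-1 - i).+1 - 1)%N by have := ltn_ord i; lia.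
rewrite natrB ?natrD; last by lia.
lra.
Qed.

Lemma c2_series_coef g n :
  (c2_series g * fps_pow14 (3 * g + 2)%:R) n = (P_poly g)`_n.+1 - (S_poly g)`_n.
Proof.
have := congr1 (fun f => f n.+1) (c2_seriesE g); rewrite /= fpsXM => ->.
by rewrite /fps_poly coefB coefXM.
Qed.

Lemma size_S_poly g : (size (S_poly g) <= 3 * g + 2)%N.
Proof.
apply: (leq_trans (size_sum _ _ _)); apply/bigmax_leqP => i _.
apply: (leq_trans (size_polyMleq _ _)).
have := size_P_poly i; have := size_P_poly (g.-1 - i); have := ltn_ord i.
by move: (size _) (size _) => a b; lia.
Qed.

Lemma c2_series_coef_int g n :
  (\sum_(i < n.+1) (c2 g i)%:Z * ('C(3 * g + 2, n - i))%:Z * (-4) ^+ (n - i))%:~R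
  = (c2_series g * fps_pow14 (3 * g + 2)%:R) n.
Proof.
rewrite fpsM rmorph_sum; apply: eq_bigr => i _.
by rewrite !rmorphM /= rmorphXn /= rmorphN /= /fps_pow14 pow14_nat mulrA.
Qed.

(** Taken from the counts themselves, so that the coefficients are integers by construction. That
    the truncation loses nothing is seen over the rationals, through the degrees of [P_poly] and
    [S_poly]. *)
Definition P2_poly (g : nat) : {poly int} := \poly_(n < 3 * g + 2)
  (\sum_(i < n.+1) (c2 g i)%:Z * ('C(3 * g + 2, n - i))%:Z * (-4) ^+ (n - i)).

Lemma c2_sum_high g n : (3 * g + 2 <= n)%N ->
  \sum_(i < n.+1) (c2 g i)%:Z * ('C(3 * g + 2, n - i))%:Z * (-4) ^+ (n - i) = 0.
Proof.
move=> h; apply: (@intr_inj rat); rewrite c2_series_coef_int c2_series_coef.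
rewrite !nth_default ?subr0 //; first by apply: leq_trans (size_S_poly g) h.
by apply: leq_trans (size_P_poly g) _; lia.
Qed.

Lemma coef_P2_poly g n : (P2_poly g)`_n
  = \sum_(i < n.+1) (c2 g i)%:Z * ('C(3 * g + 2, n - i))%:Z * (-4) ^+ (n - i).
Proof. by rewrite coef_poly; case: ltnP => // h; rewrite c2_sum_high. Qed.

Lemma coef_P2_polyQ g n : ((P2_poly g)`_n)%:~R = (P_poly g)`_n.+1 - (S_poly g)`_n.
Proof. by rewrite coef_P2_poly c2_series_coef_int c2_series_coef. Qed.

Lemma P2_polyX g : 'X * map_poly (intr : int -> rat) (P2_poly g) = P_poly g - 'X * S_poly g.
Proof.
apply/polyP => -[|n]; rewrite coefB !coefXM /=; first by rewrite coef_P_poly_low ?subr0.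
by rewrite coef_map /= coef_P2_polyQ.
Qed.

Lemma P2_poly_eval g :
  (map_poly (intr : int -> rat) (P2_poly g)).[4^-1]
  = 4%:R * P_top g - \sum_(i < g) P_top i * P_top (g.-1 - i).
Proof.
have := congr1 (fun p : {poly rat} => 4%:R * p.[4^-1]) (P2_polyX g).
rewrite /= hornerD hornerN !hornerM !hornerX mulrA mulfV // mul1r => ->.
rewrite mulrBr mulrA mulfV // mul1r; congr (_ - _).
rewrite /S_poly horner_sum; by apply: eq_bigr => i _; rewrite hornerM.
Qed.

(** * The lowest coefficients *)

Lemma c1_low g n : (n < 2 * g)%N -> c1 g n = 0%N.
Proof.
case: g => [|g] ng; first by lia.
apply/eqP; rewrite -(eqr_nat rat) -[(c1 _ _)%:R]/(c1_series g.+1 n) c1_egf_fact c1_egfE fpsM.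
rewrite big1 ?mul0r // => k _; rewrite (_ : genus_coef g k = 0) ?mul0r //.
by apply: contraTeq isT => /genus_coef_supp; have := ltn_ord k; lia.
Qed.

(** The support of [genus_coef g] starts at [2 * g.+1], so a single term of its product with the
    exponential survives. *)
Lemma c1_minimal g : (c1 g.+1 (2 * g + 2))%:R
  = ((4 * g + 4)`!)%:R / ((4 ^ g.+1 * (2 * g + 3)`!)%:R : rat).
Proof.
rewrite -[LHS]/(c1_series g.+1 _) c1_egf_fact c1_egfE fpsM big_ord_recr /= big1 => [|k _].
  rewrite add0r subnn (_ : 2 * g + 2 = 2 * g.+1)%N; last by lia.
  rewrite genus_coef_low (_ : 2 * (2 * g.+1) = 4 * g + 4)%N; last by lia.
  rewrite /fps_exp fact0 invr1 mulr1 -[RHS]mulrC -mulrAC -invfM -natrM; congr (_%:R^-1 * _).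
  by rewrite (_ : 2 * g + 3 = (2 * g.+1).+1)%N ?factS ?mulnA //; lia.
rewrite (_ : genus_coef g k = 0) ?mul0r //.
by apply: contraTeq isT => /genus_coef_supp; have := ltn_ord k; lia.
Qed.

(** [cut_recursion] bounds [c2 g n] by [c1 g.+1 n.+1]. *)
Lemma c2_low g n : (n <= 2 * g)%N -> c2 g n = 0%N.
Proof.
move=> ng; have := cut_recursion g n; rewrite c1_low; last by lia.
by case: (c2 g n).
Qed.

(** A pair of pieces of genera [h] and [g + 1 - h] requires at least [2 * g + 2] chords, one more
    than are left. *)
Lemma c2_minimal g : c2 g (2 * g + 1) = c1 g.+1 (2 * g + 2).
Proof.
rewrite (_ : 2 * g + 2 = (2 * g + 1).+1)%N ?cut_recursion; last by lia.
rewrite big1 ?addn0 // => h _; rewrite big1 // => i _.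
have [ih|ih] := ltnP i (2 * h); first by rewrite c1_low.
by rewrite [c1 (_ - h) _]c1_low ?muln0 //; have := ltn_ord h; have := ltn_ord i; lia.
Qed.

(** * Limits of rational sequences and the asymptotics *)

Definition tends_to (u : nat -> rat) (l : rat) : Prop :=
  forall eps, 0 < eps -> exists N, forall n, (N <= n)%N -> `|u n - l| < eps.

Lemma tends_eventually (u v : nat -> rat) l N :
  (forall n, (N <= n)%N -> u n = v n) -> tends_to v l -> tends_to u l.
Proof.
move=> uv vl eps e0; have [M hM] := vl eps e0; exists (maxn N M) => n.
by rewrite geq_max => /andP[Nn Mn]; rewrite uv // hM.
Qed.

Lemma tends_const c : tends_to (fun=> c) c.
Proof. by move=> eps e0; exists 0%N => n _; rewrite subrr normr0. Qed.

Lemma tendsD u v k l : tends_to u k -> tends_to v l -> tends_to (fun n => u n + v n) (k + l).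
Proof.
move=> uk vl eps e0; have e2 : 0 < eps / 2 by rewrite divr_gt0.
have [N hN] := uk _ e2; have [M hM] := vl _ e2; exists (maxn N M) => n.
rewrite geq_max => /andP[/hN a /hM b]; rewrite opprD addrACA.
by rewrite (le_lt_trans (ler_normD _ _)) // [ltRHS]splitr ltrD.
Qed.

Lemma tendsM u v k l : tends_to u k -> tends_to v l -> tends_to (fun n => u n * v n) (k * l).
Proof.
move=> uk vl eps e0.
(* The error is at most [x y + |k| y + |l| x] with [x, y < d]; [d <= 1] makes the quadratic term
   linear. *)
pose d := Num.min 1 (eps / (`|k| + `|l| + 1)).
have s0 : 0 < `|k| + `|l| + 1 by rewrite ltr_wpDl // addr_ge0.
have d0 : 0 < d by rewrite /d lt_min ltr01 divr_gt0.
have [N hN] := uk _ d0; have [M hM] := vl _ d0; exists (maxn N M) => n.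
rewrite geq_max => /andP[/hN a /hM b].
have -> : u n * v n - k * l = (u n - k) * (v n - l) + k * (v n - l) + (u n - k) * l by ring.
have le1 : d <= 1 by rewrite /d ge_min lexx.
have le2 : d * (`|k| + `|l| + 1) <= eps by rewrite -ler_pdivlMr // /d ge_min lexx orbT.
apply: (le_lt_trans (ler_normD _ _)); rewrite normrM.
apply: (le_lt_trans (lerD (ler_normD _ _) (lexx _))); rewrite !normrM.
move: `|u n - k| `|v n - l| (normr_ge0 (u n - k)) (normr_ge0 (v n - l)) a b => x y x0 y0 xd yd.
have := normr_ge0 k; have := normr_ge0 l; move: `|k| `|l| s0 le2 => K L s0 le2 L0 K0.
have yl : y < 1 by apply: lt_le_trans yd le1.
have h1 : x * y <= x by rewrite ler_piMr // ltW.
have h2 : K * y <= K * d by rewrite ler_wpM2l // ltW.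
have h3 : x * L <= d * L by rewrite ler_wpM2r // ltW.
lra.
Qed.

Lemma tends_sum (I : Type) (r : seq I) (u : I -> nat -> rat) (l : I -> rat) :
  (forall i, tends_to (u i) (l i)) ->
  tends_to (fun n => \sum_(i <- r) u i n) (\sum_(i <- r) l i).
Proof.
move=> ul; elim: r => [|i r IH].
  by apply: (tends_eventually (v := fun=> 0) (N := 0)) => [n _|]; rewrite big_nil //; apply: tends_const.
rewrite big_cons; apply: (tends_eventually (N := 0)) (tendsD (ul i) IH) => n _.
by rewrite big_cons.
Qed.

Lemma tends_prod1 (I : Type) (r : seq I) (u : I -> nat -> rat) :
  (forall i, tends_to (u i) 1) -> tends_to (fun n => \prod_(i <- r) u i n) 1.
Proof.
move=> ul; elim: r => [|i r IH].
  by apply: (tends_eventually (v := fun=> 1) (N := 0)) => [n _|]; rewrite ?big_nil //; apply: tends_const.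
rewrite -[1]mulr1; apply: (tends_eventually (N := 0)) (tendsM (ul i) IH) => n _.
by rewrite big_cons.
Qed.

Lemma tends_shift_ratio (k i : nat) : tends_to (fun n => ((n - k).+1%:R + i%:R) / n%:R) 1.
Proof.
(* The quotient differs from 1 by [(1 + i - k) / n], of absolute value at most [(k + i + 1) / n];
   the bound [n >= k] makes the subtraction exact. *)
move=> eps e0; pose x : rat := (k + i + 1)%:R / eps.
have x0 : 0 <= x by rewrite divr_ge0 // ltW.
exists (maxn k (Num.bound x).+1) => n; rewrite geq_max => /andP[kn xn].
have n0 : 0 < n%:R :> rat by rewrite ltr0n; lia.
have nx : x < n%:R by rewrite (lt_le_trans (archi_boundP x0)) // ler_nat; lia.
rewrite -[(n - k).+1%:R]natr1 natrB //.
have -> : (n%:R - k%:R + 1 + i%:R) / n%:R - 1 = (1 + i%:R - k%:R) / n%:R :> rat.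
  by field; apply: lt0r_neq0.
rewrite normrM normfV (gtr0_norm n0) ltr_pdivrMr //.
have ke : (k + i + 1)%:R < eps * n%:R :> rat by rewrite mulrC -ltr_pdivrMr.
apply: le_lt_trans ke; rewrite !natrD.
have := ler0n rat k; have := ler0n rat i; move: (k%:R : rat) (i%:R : rat) => a b b0 a0.
by rewrite ler_norml; apply/andP; split; lra.
Qed.

Lemma c2_partial_fractions g n : (c2 g n)%:R
  = \sum_(k < 3 * g + 2) (if (k <= n)%N then
      ((P2_poly g)`_k)%:~R * ('C(n - k + (3 * g + 1), 3 * g + 1)%:R * 4 ^+ (n - k)) else 0 : rat).
Proof.
rewrite (@sum_ord_supp rat (fun k => ((P2_poly g)`_k)%:~R *
    ('C(n - k + (3 * g + 1), 3 * g + 1)%:R * 4 ^+ (n - k)))) => [|k hk]; last first.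
  by rewrite coef_P2_poly c2_sum_high // mul0r.
have W : fps_pow14 (3 * g + 2)%:R * fps_pow14 (- (3 * g + 1).+1%:R) = 1.
  rewrite fps_pow14D (_ : _ - _ = 0%:R); first by rewrite fps_pow14_nat expr0.
  by rewrite (_ : (3 * g + 1).+1 = 3 * g + 2)%N ?subrr //; lia.
rewrite -[LHS]/(c2_series g n) -[c2_series g]mulr1 -W mulrA fpsM.
apply: eq_bigr => k _; rewrite coef_P2_poly c2_series_coef_int; congr (_ * _).
exact: pow14_neg_nat.
Qed.

Lemma c2_asymptotics g (p := (map_poly (intr : int -> rat) (P2_poly g)).[4^-1]) :
  p != 0 ->
  tends_to (fun n => (c2 g n)%:R
     / (p / ((3 * g + 1)`!)%:R * n%:R ^+ (3 * g + 1) * 4 ^+ n)) 1.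
Proof.
move=> p0; set d := (3 * g + 1)%N.
(* [u k n] is the binomial ['C(n - k + d, d)] divided by its asymptotic value [n ^ d / d!], so each
   term of the expansion tends to its share [c k] of [p]. *)
pose u (k n : nat) : rat := \prod_(i < d) (((n - k).+1%:R + i%:R) / n%:R).
have uT k : tends_to (u k) 1.
  by apply: (@tends_prod1 'I_d _ (fun i n => ((n - k).+1%:R + i%:R) / n%:R)) => i; apply: tends_shift_ratio.
pose c (k : nat) : rat := ((P2_poly g)`_k)%:~R * 4^-1 ^+ k.
have pE : p = \sum_(k < 3 * g + 2) c k.
  rewrite /p (horner_coef_wide (n := 3 * g + 2)).
    by apply: eq_bigr => k _; rewrite coef_map.
  by rewrite (leq_trans (size_poly _ _)) // size_poly.
have f0 : (d`!)%:R != 0 :> rat by rewrite pnatr_eq0 -lt0n fact_gt0.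
have main : tends_to (fun n => p^-1 * \sum_(k < 3 * g + 2) c k * u k n) (p^-1 * p).
  apply: tendsM; first exact: tends_const.
  rewrite [X in tends_to _ X]pE; apply: tends_sum => k.
  by have := tendsM (tends_const (c k)) (uT k); rewrite mulr1.
rewrite mulVf // in main.
apply: (tends_eventually (N := (3 * g + 2).+1)) main => n hn.
rewrite c2_partial_fractions mulr_sumr mulr_suml; apply: eq_bigr => k _.
have kn : (k <= n)%N by have := ltn_ord k; lia.
have n0 : n%:R != 0 :> rat by rewrite pnatr_eq0; lia.
have uE : u k n = (d`!)%:R * 'C(n - k + d, d)%:R / n%:R ^+ d.
  rewrite /u big_split /= prodr_const card_ord exprVn prod_rising addSn /= -bin_ffact.
  by rewrite natrM [_%:R * (d`!)%:R]mulrC.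
have E4 : 4 ^+ n = 4 ^+ (n - k) * 4 ^+ k :> rat by rewrite -exprD subnK.
rewrite kn uE /c -/d E4 exprVn.
have a0 : 4 ^+ (n - k) != 0 :> rat by rewrite expf_neq0.
have b0 : 4 ^+ k != 0 :> rat by rewrite expf_neq0.
have e0 : n%:R ^+ d != 0 :> rat by rewrite expf_neq0.
move: (4 ^+ (n - k)) a0 (4 ^+ nat_of_ord k) b0 (n%:R ^+ d) e0 (d`!%:R : rat) f0 p p0 {pE}
  => a a0 b b0 e e0 f f0 p p0.
by field; rewrite a0 b0 e0 f0 p0.
Qed.

Theorem theorem4p1 (g : nat) :
  exists P2 : {poly int},
    [/\ (size P2 <= 3 * g + 2)%N,
        (* C^[2]_g(z) (1 - 4z)^(3g+2) = P^[2]_g(z) as formal power series *)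
        (forall n : nat,
           \sum_(i < n.+1) (c2 g i)%:Z * ('C(3 * g + 2, n - i))%:Z * (-4) ^+ (n - i)
           = P2`_n),
        0 < (map_poly (intr : int -> rat) P2).[4^-1],
        (forall h : nat, (h <= 2 * g)%N -> P2`_h = 0) &
      [/\ (* P^[2]_g = z^-1 P_(g+1) - sum_(g1=1)^g P_g1 P_(g+1-g1) *)
          (forall k : nat,
             (P2`_k)%:~R
             = Pcoef g.+1 k.+1
               - \sum_(1 <= g1 < g.+1)
                   \sum_(i < k.+1) Pcoef g1 i * Pcoef (g.+1 - g1) (k - i)),
          P2`_(2 * g + 1) = (c2 g (2 * g + 1))%:Z,
          c2 g (2 * g + 1) = c1 g.+1 (2 * g + 2),
          (c1 g.+1 (2 * g + 2))%:R
            = ((4 * g + 4)`!)%:R / ((4 ^ g.+1 * (2 * g + 3)`!)%:R : rat) &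
          (* asymptotics, Gamma(3g+2) = (3g+1)! *)
          forall eps : rat, 0 < eps -> exists N : nat, forall n : nat, (N <= n)%N ->
            `| (c2 g n)%:R
                 / ((map_poly (intr : int -> rat) P2).[4^-1] / ((3 * g + 1)`!)%:R
                    * (n%:R) ^+ (3 * g + 1) * 4 ^+ n) - 1 | < eps]].
Proof.
have pos : 0 < (map_poly (intr : int -> rat) (P2_poly g)).[4^-1].
  by rewrite P2_poly_eval subr_gt0 P_top_conv.
exists (P2_poly g); split=> //.
- exact: size_poly.
- by move=> n; rewrite coef_P2_poly.
- move=> h hg; rewrite coef_P2_poly big1 // => i _; rewrite c2_low ?mul0r //.
  by have := ltn_ord i; lia.
split.
- move=> k; rewrite coef_P2_polyQ Pcoef_P_poly big_add1 big_mkord /=; congr (_ - _).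
  rewrite /S_poly coef_sum; apply: eq_bigr => i _; rewrite coefM; apply: eq_bigr => j _.
  have -> : (g.+1 - i.+1 = (g.-1 - i).+1)%N by have := ltn_ord i; lia.
  by rewrite !Pcoef_P_poly.
(* All earlier counts vanish by [c2_low], so only the last term of the convolution remains. *)
- rewrite coef_P2_poly big_ord_recr /= big1 => [|i _]; last first.
    by rewrite c2_low ?mul0r //; have := ltn_ord i; lia.
  by rewrite add0r subnn bin0 expr0 !mulr1.
- exact: c2_minimal.
- exact: c1_minimal.
- exact: (c2_asymptotics (lt0r_neq0 pos)).
Qed.
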